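(* Let $w,w'\in W_a$ be such that $\iota(w)$ and $\iota(w')$ are in the same irreducible component of the Shi variety $\widehat{X}_{W_a}$. For an integer $r$, put $I_r=\{k\in\{1,\dots,r\}: k\text{ is odd}\}$, and write $\overline{k}(w,\alpha)$ for the class of $k(w,\alpha)$ modulo the relevant integer. Then $A_w$ and $A_{w'}$ have the same orientation if and only if: 1. (when $\Phi$ is of type $A_n$) $\displaystyle\sum_{j=1}^n j\,\overline{k}(w,\alpha_j)=\sum_{j=1}^n j\,\overline{k}(w',\alpha_j)$ in $\mathbb{Z}/(n+1)\mathbb{Z}$; 2. (when $\Phi$ is of type $B_n$) $\overline{k}(w,\alpha_n)=\overline{k}(w',\alpha_n)$ in $\mathbb{Z}/2\mathbb{Z}$; 3. (when $\Phi$ is of type $C_n$) $\displaystyle\sum_{j\in I_n}\overline{k}(w,\alpha_j)=\sum_{j\in I_n}\overline{k}(w',\alpha_j)$ in $\mathbb{Z}/2\mathbb{Z}$; 4. (when $\Phi$ is of type $D_n$) the following three conditions all hold: (i) $\overline{k}(w,\alpha_{n-1})+\overline{k}(w,\alpha_n)=\overline{k}(w',\alpha_{n-1})+\overline{k}(w',\alpha_n)$ in $\mathbb{Z}/2\mathbb{Z}$; (ii) $\displaystyle\sum_{i\in I_{n-2}}2\overline{k}(w,\alpha_i)+n\overline{k}(w,\alpha_{n-1})+(n-2)\overline{k}(w,\alpha_n)=\sum_{i\in I_{n-2}}2\overline{k}(w',\alpha_i)+n\overline{k}(w',\alpha_{n-1})+(n-2)\overline{k}(w',\alpha_n)$ in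 $\mathbb{Z}/4\mathbb{Z}$; (iii) $\displaystyle\sum_{i\in I_{n-2}}2\overline{k}(w,\alpha_i)+(n-2)\overline{k}(w,\alpha_{n-1})+n\overline{k}(w,\alpha_n)=\sum_{i\in I_{n-2}}2\overline{k}(w',\alpha_i)+(n-2)\overline{k}(w',\alpha_{n-1})+n\overline{k}(w',\alpha_n)$ in $\mathbb{Z}/4\mathbb{Z}$.
   Context: Root system and groups. $V$ is a Euclidean space with inner product $\langle -,-\rangle$, $\Phi\subset V$ is an irreducible (reduced) crystallographic root system spanning $V$, with simple system $\Delta=\{\alpha_1,\dots,\alpha_n\}$ and positive roots $\Phi^+$, $m=|\Phi^+|$. For $\alpha\in\Phi$, $\alpha^\vee=2\alpha/\langle\alpha,\alpha\rangle$. Numbering of simple roots (standard): in type $A_n$, $\alpha_1,\dots,\alpha_n$ in order along the Dynkin diagram; in type $B_n$ ($n\ge2$), in order along the diagram with $\alpha_n$ the short simple root; in type $C_n$ ($n\ge2$), in order along the diagram with $\alpha_n$ the long simple root; in type $D_n$ ($n\ge4$), $\alpha_1,\dots,\alpha_{n-2}$ form a chain in order and $\alpha_{n-1},\alpha_n$ are both joined to $\alpha_{n-2}$. For $\beta\in\Phi^+$ write $\beta^\vee=c_1\alpha_1^\vee+\cdots+c_n\alpha_n^\vee$ with $c_i\in\mathbb{Z}_{\ge 0}$, and set $\mathsf{h}(\beta^\vee)=c_1+\cdots+c_n$. $W$ is the Weyl group. For $x\in V$, $\tau_x$ is the translation by $x$. For $\alpha\in\Phi$, $k\in\mathbb{Z}$,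 $s_{\alpha,k}(x)=x-(\langle\alpha^\vee,x\rangle-k)\alpha$; the affine Weyl group $W_a$ is generated by all $s_{\alpha,k}$, and $W_a=\mathbb{Z}\Phi\rtimes W$, where $\mathbb{Z}\Phi$ is identified with its group of translations. Alcoves and Shi vectors. Put $H_{\alpha,k}=\{x\in V: \langle x,\alpha^\vee\rangle=k\}$ and $H^1_{\alpha,k}=\{x\in V: k<\langle x,\alpha^\vee\rangle<k+1\}$. Alcoves are the connected components of $V\setminus\bigcup_{\alpha\in\Phi^+,k\in\mathbb{Z}}H_{\alpha,k}$. Let $A_e=\bigcap_{\alpha\in\Phi^+}H^1_{\alpha,0}$ and $A_w=wA_e$ for $w\in W_a$. The Shi coefficients $k(w,\alpha)\in\mathbb{Z}$ are defined by $A_w=\bigcap_{\alpha\in\Phi^+}H^1_{\alpha,k(w,\alpha)}$, and $\iota(w)=(k(w,\alpha))_{\alpha\in\Phi^+}$ is the Shi vector of $w$. Orientation. $A_w$ and $A_{w'}$ have the same orientation if there is $x\in\mathbb{Z}\Phi$ with $w'=\tau_xw$. Shi variety. For $\beta\in\Phi^+$ with $\beta^\vee=\sum_i c_i\alpha_i^\vee$, set $P_\beta=\sum_i c_iX_{\alpha_i}$. A vector $\lambda=(\lambda_\beta)_{\beta\in\Phi^+}$ of integers is admissible if $0\le\lambda_\beta\le \mathsf{h}(\beta^\vee)-1$ for all $\beta\in\Phi^+$. It is admitted if in addition, for all $\alpha,\beta\in\Phi^+$ with $\alpha+\beta\in\Phi^+$, $$\|\alpha\|^2\lambda_\alpha+\|\beta\|^2\lambda_\beta+1\le\|\alpha+\beta\|^2(\lambda_{\alpha+\beta}+1)\le\|\alpha\|^2\lambda_\alpha+\|\beta\|^2\lambda_\beta+\|\alpha\|^2+\|\beta\|^2+\|\alpha+\beta\|^2-1.$$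 For admitted $\lambda$, $X_{W_a}[\lambda]\subset\mathbb{R}^{\Phi^+}=\mathbb{R}^m$ is the affine subspace of points $(x_\beta)_{\beta\in\Phi^+}$ with $x_\beta=P_\beta(x_{\alpha_1},\dots,x_{\alpha_n})+\lambda_\beta$ for all $\beta\in\Phi^+$. The Shi variety is the disjoint union $\widehat{X}_{W_a}=\bigsqcup_{\lambda\text{ admitted}}X_{W_a}[\lambda]$; its irreducible components are the $X_{W_a}[\lambda]$, and $\iota$ is a bijection from $W_a$ onto the integral points of $\widehat{X}_{W_a}$. *)

(* Defs.v *)
From HB Require Import structures.
From mathcomp Require Import all_boot all_order all_algebra.
From mathcomp Require Import sesquilinear finmap mpoly.
From mathcomp Require Import boolp classical_sets reals.

Set Implicit Arguments.
Unset Strict Implicit.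
Unset Printing Implicit Defensive.

Import Order.TTheory GRing.Theory Num.Theory.

Local Open Scope classical_set_scope.
Local Open Scope ring_scope.

Section Zariski.
Context {R : fieldType} {I : finType}.

(* The coordinates of affine space R^I are numbered through [enum_val], since
   [{mpoly R[m]}] has its variables indexed by ['I_m]. *)
Definition vanishing (P : set {mpoly R[#|I|]}) : set {ffun I -> R} :=
  [set x | forall p, P p -> p.@[fun i => x (enum_val i)] = 0].

Definition zariski_closed (F : set {ffun I -> R}) : Prop :=
  exists P : set {mpoly R[#|I|]}, F = vanishing P.

Definition zariski_irreducible (Z : set {ffun I -> R}) : Prop :=
  Z !=set0 /\
  forall F G, zariski_closed F -> zariski_closed G ->
    Z `<=` F `|` G -> Z `<=` F \/ Z `<=` G.

Definition irreducible_component (X Z : set {ffun I -> R}) : Prop :=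
  [/\ Z `<=` X, zariski_irreducible Z &
      forall Z', zariski_irreducible Z' -> Z `<=` Z' -> Z' `<=` X -> Z' = Z].

End Zariski.

Section RootSystem.
Context {R : realType} {V : vectType R}.
Variables (ip : {dot V for idfun}) (Phi : {fset V}).

Definition coroot (a : V) : V := (2 / ip a a) *: a.

Definition refl (a x : V) : V := x - ip x (coroot a) *: a.

Definition root_system : Prop :=
  [/\ 0 \notin Phi /\ <<Phi>>%VS = fullv,
      forall a b, a \in Phi -> b \in Phi -> refl a b \in Phi,
      forall a b, a \in Phi -> b \in Phi -> ip a (coroot b) \is a Num.int &
      forall a c, a \in Phi -> c *: a \in Phi -> c = 1 \/ c = -1].

Definition irreducible_roots : Prop :=
  Phi <> fset0 /\
  forall S T : {fset V}, Phi = (S `|` T)%fset ->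
    (forall a b, a \in S -> b \in T -> ip a b = 0) ->
    S = fset0 \/ T = fset0.

Definition translation (x v : V) : V := v + x.

Definition root_lattice (x : V) : Prop := inIntSpan (in_tuple Phi) x.

Definition aff_refl (a : V) (k : int) (x : V) : V :=
  x - (ip (coroot a) x - k%:~R) *: a.

(* The generators are involutions, so that the group that they generate is the
   set of their finite products. *)
Inductive affine_weyl : (V -> V) -> Prop :=
| affine_weyl_id : affine_weyl id
| affine_weyl_refl a k w :
    a \in Phi -> affine_weyl w -> affine_weyl (aff_refl a k \o w).

Definition strip (a : V) (k : int) : set V :=
  [set x | k%:~R < ip x (coroot a) < k%:~R + 1].

Definition same_orientation (w w' : V -> V) : Prop :=
  exists x, root_lattice x /\ w' = translation x \o w.

Section Simple.
Context {n : nat}.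
Variable alpha : n.-tuple V.

Definition simple_system : Prop :=
  [/\ basis_of fullv alpha, {subset alpha <= Phi} &
      forall b, b \in Phi -> exists c : 'I_n -> nat,
        b = \sum_i tnth alpha i *+ c i \/ b = - \sum_i tnth alpha i *+ c i].

(* The simple roots are numbered from 1. *)
Definition sroot (j : nat) : V := alpha`_j.-1.

(* This is the number of edges joining a and b in the Dynkin diagram. *)
Definition bond (a b : V) : R := ip a (coroot b) * ip b (coroot a).

Definition type_A : Prop :=
  forall i j, (0 < i)%N -> (i < j)%N -> (j <= n)%N ->
    bond (sroot i) (sroot j) = (j == i.+1)%:R.

Definition double_end : Prop :=
  forall i j, (0 < i)%N -> (i < j)%N -> (j <= n)%N ->
    bond (sroot i) (sroot j) =
      (if j == i.+1 then if j == n then 2 else 1 else 0).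

Definition type_B : Prop :=
  [/\ (2 <= n)%N, double_end &
      forall i, (0 < i)%N -> (i < n)%N ->
        ip (sroot n) (sroot n) < ip (sroot i) (sroot i)].

Definition type_C : Prop :=
  [/\ (2 <= n)%N, double_end &
      forall i, (0 < i)%N -> (i < n)%N ->
        ip (sroot i) (sroot i) < ip (sroot n) (sroot n)].

Definition type_D : Prop :=
  (4 <= n)%N /\
  forall i j, (0 < i)%N -> (i < j)%N -> (j <= n)%N ->
    bond (sroot i) (sroot j) =
      (if j == n then i == (n - 2)%N else j == i.+1)%:R.

Definition pos_roots : {fset V} :=
  [fset b in Phi | [forall i, 0 <= coord alpha i b]]%fset.

(* R^(Phi^+) is [{ffun pos_roots -> R}]; this is the coordinate of the point x
   at the root a given as a vector, with junk value 0 outside of Phi^+. *)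
Definition entry (T : nmodType) (x : {ffun pos_roots -> T}) (a : V) : T :=
  if insub a is Some b then x b else 0.

Definition base_alcove : set V := \bigcap_(b : pos_roots) strip (val b) 0.

Definition alcove (w : V -> V) : set V := w @` base_alcove.

(* For w in the affine Weyl group there is exactly one such vector. *)
Definition shi_vector (w : V -> V) : {ffun pos_roots -> int} :=
  xget 0 [set k : {ffun pos_roots -> int} | alcove w = \bigcap_(b : pos_roots) strip (val b) (k b)].

Definition shi_coef (w : V -> V) (a : V) : int := entry (shi_vector w) a.

Definition shi_point (w : V -> V) : {ffun pos_roots -> R} :=
  [ffun b => (shi_vector w b)%:~R].

Definition coroot_coef (b : V) (i : 'I_n) : R :=
  coord (map_tuple coroot alpha) i (coroot b).

Definition height (b : V) : R := \sum_i coroot_coef b i.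

Definition admissible (l : {ffun pos_roots -> int}) : Prop :=
  forall b : pos_roots, 0 <= l b /\ (l b)%:~R <= height (val b) - 1.

Definition admitted (l : {ffun pos_roots -> int}) : Prop :=
  admissible l /\
  forall a b c : pos_roots, val c = val a + val b ->
    let N (d : pos_roots) := ip (val d) (val d) in
    let L (d : pos_roots) : R := (l d)%:~R in
    N a * L a + N b * L b + 1 <= N c * (L c + 1) /\
    N c * (L c + 1) <= N a * L a + N b * L b + N a + N b + N c - 1.

Definition shi_piece (l : {ffun pos_roots -> int}) : set {ffun pos_roots -> R} :=
  [set x : {ffun pos_roots -> R} | forall b : pos_roots,
    x b = \sum_i coroot_coef (val b) i * entry x (tnth alpha i) + (l b)%:~R].

Definition shi_variety : set {ffun pos_roots -> R} :=
  \bigcup_(l in [set l : {ffun pos_roots -> int} | admitted l]) shi_piece l.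

End Simple.
End RootSystem.

Arguments shi_variety {R V} ip Phi {n} alpha.

(* Main.v *)
(* Two points of a component of the Shi variety have the same offsets
   x_b - P_b(x), because each offset takes finitely many values on the variety.
   Hence the Shi vectors of w and w' differ by the vector <x, b^vee> for the
   weight x with <x, alpha_j^vee> = d_j = k(w', alpha_j) - k(w, alpha_j), and the
   alcoves of w' and of tau_x w coincide. If x lies in the root lattice, then
   tau_x w = w', as the affine Weyl group acts freely on alcoves; conversely a
   translation carrying w to w' must be tau_x. So the orientations agree exactly
   when d lies in the lattice spanned by the rows of the Cartan matrix. Along a
   simply laced chain the equations d_j = 2 m_j - m_(j-1) - m_(j+1) determine m
   from m_1, and the equations at the end of the diagram become the congruences.

   Freeness is proved by the exchange condition for the reflections in the walls
   of the base alcove, which are given by the simple roots and by the coroots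
   that are maximal for the order defined by the simple roots. *)

Require Import Defs.
From HB Require Import structures.
From mathcomp Require Import all_boot all_order all_algebra.
From mathcomp Require Import sesquilinear finmap mpoly.
From mathcomp Require Import boolp classical_sets reals.
From mathcomp Require Import ring lra zify.

Set Implicit Arguments.
Unset Strict Implicit.
Unset Printing Implicit Defensive.

Import Order.TTheory GRing.Theory Num.Theory.

Local Open Scope ring_scope.

(** * Roots and coroots *)

Section Geometry.
Context {R : realType} {V : vectType R}.
Variable ip : {dot V for idfun}.
Implicit Types (a b x y : V) (c : R).

Lemma ipC x y : ip x y = ip y x.
Proof. by rewrite (hermC ip) mul1r. Qed.

Lemma ip_gt0 x : x != 0 -> 0 < ip x x.
Proof. exact: neq0_dnorm_gt0. Qed.

Lemma ipDr x y z : ip x (y + z) = ip x y + ip x z.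
Proof. exact: linearDr. Qed.

Lemma ipZr c x y : ip x (c *: y) = c * ip x y.
Proof. by rewrite linearZr. Qed.

Lemma ip0r x : ip x 0 = 0.
Proof. by rewrite -(scale0r 0) ipZr mul0r. Qed.

Lemma ipNr x y : ip x (- y) = - ip x y.
Proof. by rewrite -scaleN1r ipZr mulN1r. Qed.

Lemma ipDl x y z : ip (x + y) z = ip x z + ip y z.
Proof. by rewrite ![ip _ z]ipC ipDr. Qed.

Lemma ipZl c x y : ip (c *: x) y = c * ip x y.
Proof. by rewrite ![ip _ y]ipC ipZr. Qed.

Lemma ipNl x y : ip (- x) y = - ip x y.
Proof. by rewrite ![ip _ y]ipC ipNr. Qed.

Lemma ip0l x : ip 0 x = 0.
Proof. by rewrite ipC ip0r. Qed.

Lemma ip_suml I (r : seq I) (P : pred I) (F : I -> V) y :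
  ip (\sum_(i <- r | P i) F i) y = \sum_(i <- r | P i) ip (F i) y.
Proof. by apply: (big_morph (ip^~ y)) => [u v|]; rewrite ?ipDl ?ip0l. Qed.

Lemma ip_sumr I (r : seq I) (P : pred I) (F : I -> V) x :
  ip x (\sum_(i <- r | P i) F i) = \sum_(i <- r | P i) ip x (F i).
Proof. by apply: (big_morph (ip x)) => [u v|]; rewrite ?ipDr ?ip0r. Qed.

Lemma coroot_self a : a != 0 -> ip a (coroot ip a) = 2.
Proof. by move=> /ip_gt0 /lt0r_neq0 aN0; rewrite ipZr mulfVK. Qed.

Lemma corootN a : coroot ip (- a) = - coroot ip a.
Proof. by rewrite /coroot ipNl ipNr opprK scalerN. Qed.

Lemma corootK a : a != 0 -> coroot ip (coroot ip a) = a.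
Proof.
move=> /ip_gt0 /lt0r_neq0 aN0; rewrite /coroot !ipZl !ipZr scalerA.
by rewrite [X in X *: _](_ : _ = 1) ?scale1r//; field.
Qed.

Lemma coroot_neq0 a : a != 0 -> coroot ip a != 0.
Proof.
by move=> a0; rewrite scaler_eq0 (negPf a0) orbF mulf_neq0 ?invr_eq0 ?gt_eqF ?ip_gt0.
Qed.

Lemma coroot_ip_gt0 a b : b != 0 -> (0 < ip a (coroot ip b)) = (0 < ip a b).
Proof. by move=> b0; rewrite ipZr pmulr_rgt0// divr_gt0 ?ip_gt0. Qed.

Lemma coroot_ip_ge0 a b : b != 0 -> (0 <= ip a (coroot ip b)) = (0 <= ip a b).
Proof. by move=> b0; rewrite ipZr pmulr_rge0// divr_gt0 ?ip_gt0. Qed.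

Lemma coroot_ip_eq0 a b : b != 0 -> (ip a (coroot ip b) == 0) = (ip a b == 0).
Proof.
move=> b0; rewrite ipZr mulf_eq0 [X in X || _](_ : _ = false)//.
by rewrite gt_eqF// divr_gt0 ?ip_gt0.
Qed.

Lemma refl_orthogonal a b : a != 0 -> b != 0 ->
  ip a (coroot ip b) = 0 -> refl ip a b = b.
Proof.
move=> a0 b0 /eqP; rewrite coroot_ip_eq0// ipC -coroot_ip_eq0// => /eqP ba0.
by rewrite /refl ba0 scale0r subr0.
Qed.

Lemma reflZ a c x : refl ip a (c *: x) = c *: refl ip a x.
Proof. by rewrite /refl ipZl scalerBr scalerA. Qed.

Lemma ip_refl a x y : a != 0 -> ip (refl ip a x) (refl ip a y) = ip x y.
Proof.
move=> a0; rewrite /refl !(ipDl, ipNl, ipDr, ipNr, ipZl, ipZr) (ipC a y).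
by have /lt0r_neq0 aN0 := ip_gt0 a0; field.
Qed.

Lemma reflK a : a != 0 -> involutive (refl ip a).
Proof.
move=> a0 x; rewrite {1}/refl /refl ipDl ipNl ipZl coroot_self//.
by rewrite mulr_natr mulr2n opprD addrA subrr sub0r scaleNr opprK addrNK.
Qed.

Lemma refl_self a : a != 0 -> refl ip a a = - a.
Proof. by move=> a0; rewrite /refl coroot_self// scaler_nat mulr2n opprD addNKr. Qed.

Lemma coroot_refl a b : a != 0 ->
  coroot ip (refl ip a b) = coroot ip b - ip a (coroot ip b) *: coroot ip a.
Proof.
move=> a0; rewrite {1}/coroot ip_refl// /refl scalerBr; congr (_ - _).
by rewrite /coroot !ipZr !scalerA (ipC b a); congr (_ *: _); ring.
Qed.

(* This is the strict Cauchy-Schwarz inequality. *)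
Lemma cartan_product_lt4 a b : a != 0 -> b != 0 ->
    (forall c, a != c *: b) ->
  ip a (coroot ip b) * ip b (coroot ip a) < 4.
Proof.
move=> a0 b0 ab; have := ip_gt0 a0; have := ip_gt0 b0 => bb aa.
have: 0 < ip (a - (ip a b / ip b b) *: b) (a - (ip a b / ip b b) *: b).
  by apply: ip_gt0; rewrite subr_eq0 ab.
rewrite !(ipDl, ipNl, ipDr, ipNr, ipZl, ipZr) (ipC b a).
have bN := lt0r_neq0 bb; have aN := lt0r_neq0 aa.
rewrite [X in 0 < X](_ : _ = (ip a a * ip b b - ip a b ^+ 2) / ip b b); last by field.
rewrite pmulr_lgt0 ?invr_gt0// subr_gt0 => h.
rewrite [X in X < _](_ : _ = 4 * (ip a b ^+ 2) / (ip a a * ip b b)); last first.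
  by field; apply/andP; split.
by rewrite ltr_pdivrMr ?mulr_gt0// ltr_pM2l.
Qed.

End Geometry.

(** * Simple systems, the positive cone and a point of the base alcove *)

Section Roots.
Context {R : realType} {V : vectType R} (ip : {dot V for idfun}) (Phi : {fset V}).
Context {n : nat} (alpha : n.-tuple V).
Hypothesis root_sys : root_system ip Phi.
Hypothesis simple : simple_system Phi alpha.
Implicit Types (a b u v x y : V) (i j : 'I_n).
Local Notation coroot := (coroot ip).
Local Notation refl := (refl ip).
Local Notation al := (tnth alpha).

Lemma root_neq0 b : b \in Phi -> b != 0.
Proof. by case: root_sys => -[h _] _ _ _ hb; apply: contraNneq h => <-. Qed.

Lemma root_refl a b : a \in Phi -> b \in Phi -> refl a b \in Phi.
Proof. by case: root_sys => _ h _ _; apply: h. Qed.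

Lemma root_int a b : a \in Phi -> b \in Phi -> ip a (coroot b) \is a Num.int.
Proof. by case: root_sys => _ _ h _; apply: h. Qed.

Lemma root_opp b : b \in Phi -> - b \in Phi.
Proof. by move=> hb; rewrite -(refl_self ip (root_neq0 hb)) root_refl. Qed.

Lemma root_prop a c : a \in Phi -> c *: a \in Phi -> c = 1 \/ c = -1.
Proof. by case: root_sys => _ _ _; apply. Qed.

Lemma simple_root i : al i \in Phi.
Proof. by case: simple => _ h _; apply: h; apply: mem_tnth. Qed.

Lemma coord_simple i j : coord alpha j (al i) = (i == j)%:R.
Proof.
case: simple => /andP[_ fr] _ _; by rewrite (tnth_nth 0) coord_free ?eqxx.
Qed.

Lemma simple_decomp v : v = \sum_i coord alpha i v *: al i.
Proof.
case: simple => bs _ _; rewrite {1}(coord_basis bs (memvf v)).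
by apply: eq_bigr => i _; rewrite (tnth_nth 0).
Qed.

Lemma coord_ext u v : (forall i, coord alpha i u = coord alpha i v) -> u = v.
Proof.
by move=> h; rewrite (simple_decomp u) (simple_decomp v); under eq_bigr do rewrite h.
Qed.

Definition cone v := forall i, 0 <= coord alpha i v.

Lemma coneD u v : cone u -> cone v -> cone (u + v).
Proof. by move=> hu hv i; rewrite linearD; apply: addr_ge0 (hu i) (hv i). Qed.

Lemma coneZ (c : R) v : 0 <= c -> cone v -> cone (c *: v).
Proof. by move=> hc hv i; rewrite linearZ; apply: mulr_ge0 hc (hv i). Qed.

Lemma cone_simple i : cone (al i).
Proof. by move=> j; rewrite coord_simple ler0n. Qed.

Lemma cone_antisym v : cone v -> cone (- v) -> v = 0.
Proof.
move=> h h'; apply: coord_ext => i; rewrite linear0; apply/eqP.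
by rewrite eq_le h andbT -oppr_ge0 -linearN h'.
Qed.

Lemma root_cone b : b \in Phi -> cone b \/ cone (- b).
Proof.
move=> hb; case: simple => _ _ /(_ b hb)[c hc].
suff h : cone (\sum_i al i *+ c i) by case: hc => ->; [left|right; rewrite opprK].
move=> j; rewrite linear_sum sumr_ge0// => i _.
by rewrite linearMn /= coord_simple mulrn_wge0.
Qed.

Lemma cone_coroot b : b != 0 -> cone b -> cone (coroot b).
Proof. by move=> b0; apply: coneZ; rewrite divr_ge0// ltW// ip_gt0. Qed.

Lemma cone_coroot_inv b : b != 0 -> cone (coroot b) -> cone b.
Proof. by move=> b0 /(cone_coroot (coroot_neq0 ip b0)); rewrite corootK. Qed.

Lemma cone_ip_ge0 x v : (forall i, 0 <= ip x (al i)) -> cone v -> 0 <= ip x v.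
Proof.
move=> hx hv; rewrite (simple_decomp v) ip_sumr sumr_ge0// => i _.
by rewrite ipZr mulr_ge0.
Qed.

Lemma cone_ip_gt0 x v :
  (forall i, 0 < ip x (al i)) -> cone v -> v != 0 -> 0 < ip x v.
Proof.
move=> hx hv v0; rewrite lt_neqAle cone_ip_ge0// ?andbT; last by move=> i; exact: ltW.
apply: contra v0; rewrite eq_sym {1}(simple_decomp v) ip_sumr psumr_eq0 => [|i _]; last first.
  by rewrite ipZr mulr_ge0// ltW.
move=> /allP h; apply/eqP/coord_ext => i; rewrite linear0.
have := h i (mem_index_enum _); rewrite ipZr mulf_eq0 => /orP[/eqP//|].
by rewrite gt_eqF.
Qed.

Lemma cartan_simple_le0 i j : i != j -> ip (al i) (coroot (al j)) <= 0.
Proof.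
move=> ij; case: (root_cone (root_refl (simple_root j) (simple_root i))).
  move=> /(_ j); rewrite linearB linearZ /= !coord_simple eqxx (negPf ij) /=.
  by rewrite sub0r mulr1 oppr_ge0.
move=> /(_ i); rewrite linearN linearB linearZ /= !coord_simple eqxx eq_sym (negPf ij).
by rewrite mulr0 subr0 oppr_ge0 ler10.
Qed.

(** The reflection changes only coordinate [i]. If the image were negative, all other coordinates of
    [b] would vanish, and reducedness would force [b] to be [al i]. *)
Lemma simple_refl_cone i b : b \in Phi -> cone b -> b != al i -> cone (refl (al i) b).
Proof.
move=> hb cb bi; case: (root_cone (root_refl (simple_root i) hb)) => // h.
have b0 j : j != i -> coord alpha j b = 0.
  move=> ji; have := h j; rewrite linearN linearB linearZ /= coord_simple.
  rewrite eq_sym (negPf ji) mulr0 subr0 oppr_ge0 => h1; apply/eqP.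
  by rewrite eq_le h1 cb.
have bE : b = coord alpha i b *: al i.
  by rewrite {1}(simple_decomp b) (bigD1 i)//= big1 ?addr0// => j /b0 ->; rewrite scale0r.
case: (@root_prop (al i) (coord alpha i b)); rewrite -?bE ?simple_root// => c1.
  by move: bi; rewrite bE c1 scale1r eqxx.
by have := cb i; rewrite c1 ler0N1.
Qed.

(** The Gram matrix of the simple roots is invertible: a combination in its kernel is orthogonal to
    every simple root, hence to itself. *)
Lemma ip_solve (d : 'I_n -> R) : exists x, forall i, ip x (al i) = d i.
Proof.
pose G := \matrix_(i, j) ip (al i) (al j) : 'M[R]_n.
have GE (u : 'rV_n) j : (u *m G) 0 j = ip (\sum_i u 0 i *: al i) (al j).
  by rewrite mxE ip_suml; apply: eq_bigr => i _; rewrite mxE ipZl.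
have Gu : G \in unitmx.
  rewrite -row_free_unit; apply: inj_row_free => u uG.
  set v := \sum_i u 0 i *: al i.
  have v0 : v = 0.
    apply/eqP; apply: contraT => /(ip_gt0 ip); rewrite {2}/v ip_sumr big1 ?ltxx// => j _.
    by rewrite ipZr /v -GE uG mxE mulr0.
  apply/rowP => j; rewrite mxE -(linear0 (coord alpha j)) -v0 linear_sum (bigD1 j)//=.
  rewrite big1 ?addr0 => [|i /negPf ij]; rewrite linearZ /= coord_simple ?eqxx ?mulr1//.
  by rewrite ij mulr0.
exists (\sum_i (\row_i d i *m invmx G) 0 i *: al i) => j.
by rewrite -GE mulmxKV// mxE.
Qed.

Lemma base_point_exists : exists p,
  (forall i, 0 < ip p (al i)) /\ forall b, b \in Phi -> `|ip p (coroot b)| < 1.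
Proof.
have [x hx] := ip_solve (fun=> 1).
pose M := 1 + \sum_(b : Phi) `|ip x (coroot (val b))|.
have M0 : 0 < M by rewrite ltr_wpDr// sumr_ge0.
exists (M^-1 *: x); split=> [i|b hb]; first by rewrite ipZl hx mulr1 invr_gt0.
rewrite ipZl normrM normfV (gtr0_norm M0) mulrC ltr_pdivrMr// mul1r /M.
by rewrite (bigD1 [` hb]%fset)//= addrCA ltrDl ltr_wpDr// sumr_ge0.
Qed.

End Roots.

(** * Affine coroots *)

Section AffineWeyl.
Context {R : realType} {V : vectType R} (ip : {dot V for idfun}) (Phi : {fset V}).
Context {n : nat} (alpha : n.-tuple V).
Hypothesis root_sys : root_system ip Phi.
Hypothesis simple : simple_system Phi alpha.
Local Notation coroot := (coroot ip).
Local Notation refl := (refl ip).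
Local Notation al := (tnth alpha).
Local Notation cone := (cone alpha).
Variable p : V.
Hypothesis p_dom : forall i, 0 < ip p (al i).
Hypothesis p_small : forall b, b \in Phi -> `|ip p (coroot b)| < 1.
Implicit Types (a b c t x y : V) (f g h : V * int).

(* The pair (b, k) stands for the affine function x |-> <x, b^vee> + k. *)
Definition affval f x : R := ip x (coroot f.1) + f.2%:~R.

Definition affrefl f x : V := x - affval f x *: f.1.

(** This is the pullback of [f] along the reflection in the zero hyperplane of [g]; [floor] turns
    the Cartan number, an integer for roots, into an [int]. *)
Definition affact g f : V * int :=
  (refl g.1 f.1, f.2 - Num.floor (ip g.1 (coroot f.1)) * g.2).

(** Since [p] lies in the base alcove, which no hyperplane meets, the sign at [p] is the sign on the
    whole alcove. *)
Definition affpos f : bool := 0 < affval f p.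

Lemma arefl_aff f : affrefl f = aff_refl ip f.1 (- f.2).
Proof.
by apply/funext => x; rewrite /affrefl /affval /aff_refl rmorphN opprK /= (ipC ip x).
Qed.

Lemma aval_arefl f g x : g.1 \in Phi -> f.1 \in Phi ->
  affval f (affrefl g x) = affval (affact g f) x.
Proof.
move=> hg hf; rewrite /affval /affrefl /affact /= (coroot_refl ip _ (root_neq0 root_sys hg)).
rewrite rmorphB rmorphM /= (floorK (root_int root_sys hg hf)) /affval.
by rewrite !(ipDl, ipNl, ipZl) !(ipDr, ipNr, ipZr); ring.
Qed.

Lemma aact_root f g : g.1 \in Phi -> f.1 \in Phi -> (affact g f).1 \in Phi.
Proof. exact: root_refl. Qed.

Lemma aval_arefl_self f x : f.1 \in Phi -> affval f (affrefl f x) = - affval f x.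
Proof.
move=> hf; rewrite {1}/affval /affrefl ipDl ipNl ipZl.
by rewrite (coroot_self ip (root_neq0 root_sys hf)) /affval; ring.
Qed.

Lemma areflK f : f.1 \in Phi -> involutive (affrefl f).
Proof.
by move=> hf x; rewrite {1}/affrefl aval_arefl_self// scaleNr opprK /affrefl addrNK.
Qed.

Lemma arefl_aact f g x : g.1 \in Phi -> f.1 \in Phi ->
  affrefl (affact g f) x = affrefl g (affrefl f (affrefl g x)).
Proof.
move=> hg hf; set y := affrefl g x.
have -> : affrefl g (affrefl f y) = affrefl g y - affval f y *: refl g.1 f.1.
  have gE : affval g (y - affval f y *: f.1) = affval g y - affval f y * ip f.1 (coroot g.1).
    by rewrite /affval ipDl ipNl ipZl; ring.
  rewrite {1}[affrefl f y]/affrefl {1}[affrefl g _]/affrefl gE /affrefl /Defs.refl.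
  by rewrite scalerBl scalerBr scalerA !opprD !opprK addrACA.
by rewrite /y areflK// aval_arefl.
Qed.

Lemma root_ip_p b : b \in Phi ->
  (cone b /\ 0 < ip p (coroot b) < 1) \/ (cone (- b) /\ -1 < ip p (coroot b) < 0).
Proof.
move=> hb; have b0 := root_neq0 root_sys hb.
have := p_small hb; rewrite ltr_norml => /andP[h1 h2].
have [cb|cb] := root_cone simple hb; [left|right]; split => //.
  by rewrite coroot_ip_gt0// h2 (cone_ip_gt0 simple p_dom cb b0).
rewrite h1 -oppr_gt0 -ipNr -corootN coroot_ip_gt0 ?oppr_eq0//.
by rewrite (cone_ip_gt0 simple p_dom cb)// oppr_eq0.
Qed.

Lemma positiveP f : f.1 \in Phi -> affpos f ->
  (cone f.1 /\ 0 <= f.2) \/ (cone (- f.1) /\ 1 <= f.2).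
Proof.
rewrite /affpos /affval => hf h.
have [[cf /andP[h1 h2]]|[cf /andP[h1 h2]]] := root_ip_p hf; [left|right]; split=> //.
  rewrite -ltzD1 -(ltr_int R) rmorphD /=; lra.
rewrite -gtz0_ge1 -(ltr_int R) /=; lra.
Qed.

Lemma positive_ge1 f : f.1 \in Phi -> 1 <= f.2 -> affpos f.
Proof.
move=> hf; rewrite /affpos /affval -(ler_int R) /= => h.
by have := p_small hf; rewrite ltr_norml; lra.
Qed.

Lemma positive_cone f : f.1 \in Phi -> cone f.1 -> 0 <= f.2 -> affpos f.
Proof.
move=> hf cf; rewrite /affpos /affval -(ler_int R) /= => h.
have [[_]|[cf']] := root_ip_p hf; first by lra.
by have := root_neq0 root_sys hf; rewrite (cone_antisym simple cf cf') eqxx.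
Qed.

Lemma positive_or_neg f : f.1 \in Phi -> ~~ affpos f -> affval f p < 0.
Proof.
move=> hf; rewrite /affpos -leNgt le_eqVlt => /orP[/eqP h|//].
have : ip p (coroot f.1) = - f.2%:~R by apply/eqP; rewrite -addr_eq0; apply/eqP.
rewrite -rmorphN /= => hE.
have [[_]|[_]] := root_ip_p hf; rewrite hE -[1]/(1%:~R) -[0]/(0%:~R);
  by rewrite -?rmorphN /= ?ltr_int; lia.
Qed.

(** The order is on coroots because coroots cut out the walls: for irreducible [Phi], [t^vee] is the
    highest coroot and [t] the highest short root. *)
Definition maximal_root t :=
  [/\ t \in Phi, cone t & forall b, b \in Phi -> cone (coroot b - coroot t) -> b = t].

Lemma coroot_inj a b : a \in Phi -> b \in Phi -> coroot a = coroot b -> a = b.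
Proof.
move=> ha hb e; rewrite -(corootK ip (root_neq0 root_sys ha)) e.
by rewrite corootK// (root_neq0 root_sys hb).
Qed.

Lemma maximal_root_exists c : c \in Phi -> cone c ->
  exists t, maximal_root t /\ cone (coroot t - coroot c).
Proof.
move=> hc cc; pose P (b : Phi) := `[< cone (coroot (val b) - coroot c) >].
have Pc : P [` hc]%fset by apply/asboolP; rewrite subrr => i; rewrite linear0.
case: (arg_maxP (fun b : Phi => ip p (coroot (val b))) Pc) => /= t /asboolP ct tmax.
have t0 := root_neq0 root_sys (valP t); exists (val t); split=> //; split.
- exact: (valP t).
- apply: (@cone_coroot_inv _ _ ip _ _ _ t0).
  by have := coneD ct (cone_coroot ip (root_neq0 root_sys hc) cc); rewrite subrK.
move=> b hb cb; apply: coroot_inj => //; first exact: valP.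
apply/eqP; rewrite -subr_eq0; apply: contraT => bt.
have := cone_ip_gt0 simple p_dom cb bt; rewrite ipDr ipNr subr_gt0 ltNge.
rewrite (tmax [` hb]%fset)//; apply/asboolP => /=.
by have := coneD cb ct; rewrite addrA subrK.
Qed.

(** If [t] had a negative product with some simple root, reflecting in that root would give a coroot
    strictly above [t^vee]. *)
Lemma maximal_root_dominant t : maximal_root t ->
  forall c, c \in Phi -> cone c -> 0 <= ip t (coroot c).
Proof.
case=> ht ct tmax c hc cc; have t0 := root_neq0 root_sys ht.
have c0 := root_neq0 root_sys hc.
rewrite coroot_ip_ge0//; apply: (cone_ip_ge0 simple _ cc) => i.
have hi := simple_root simple i; have i0 := root_neq0 root_sys hi.
rewrite leNgt; apply/negP => neg.
have E := coroot_refl ip t i0.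
have il0 : ip (al i) (coroot t) < 0.
  by rewrite -oppr_gt0 -ipNl coroot_ip_gt0// ipNl oppr_gt0 ipC.
have /(congr1 coroot) : refl (al i) t = t.
  apply: tmax; first exact: root_refl.
  rewrite E addrAC subrr sub0r -scaleNr; apply: coneZ; first by rewrite oppr_ge0 ltW.
  by apply: cone_coroot => //; apply: (cone_simple simple).
rewrite E => /eqP; rewrite -subr_eq0 addrAC subrr sub0r oppr_eq0 scaler_eq0.
by rewrite lt_eqF//= (negPf (coroot_neq0 ip i0)).
Qed.

(** If [m = <t, c^vee>] is positive, then [c^vee - m t^vee] is a negative coroot, since otherwise
    [c^vee] would lie above [t^vee]. By strict Cauchy-Schwarz the two Cartan numbers have product
    less than 4, so the case [m >= 2] to be excluded has the other number equal to 1. *)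
Lemma maximal_root_cartan t c : maximal_root t -> c \in Phi -> cone c -> c != t ->
  ip t (coroot c) = 0 \/ (ip t (coroot c) = 1 /\ cone (- refl t c)).
Proof.
move=> tm hc cc ct; have dom := maximal_root_dominant tm hc cc.
case: (tm) => ht ctt tmax.
have t0 := root_neq0 root_sys ht; have c0 := root_neq0 root_sys hc.
have tc_prop (k : R) : t != k *: c.
  apply/eqP => tE.
  have := ht; rewrite tE => /(root_prop root_sys hc)[] k1.
    by move: ct; rewrite tE k1 scale1r eqxx.
  move: ctt; rewrite tE k1 scaleN1r => /(cone_antisym simple cc) c00.
  by rewrite c00 eqxx in c0.
have := cartan_product_lt4 ip t0 c0 tc_prop.
have := floorK (root_int root_sys ht hc); have := floorK (root_int root_sys hc ht).
set m := Num.floor (ip t _); set m' := Num.floor (ip c _) => mE' mE.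
rewrite -mE -mE' -rmorphM -[4]/(4%:~R) ltr_int => lt4.
have m_ge0 : 0 <= m by rewrite -(ler_int R) mE.
have [m0|m_gt0] : m = 0 \/ 0 < m by lia.
  by left; rewrite m0.
right.
have m'_gt0 : 0 < m'.
  rewrite -(ltr_int R) mE' coroot_ip_gt0// ipC -(coroot_ip_gt0 ip t c0) -mE.
  by rewrite ltr0z.
have E := coroot_refl ip c t0; rewrite -mE in E.
have rc0 : refl t c != 0 by apply/(root_neq0 root_sys)/root_refl.
have neg : cone (- refl t c).
  have [h|//] := root_cone simple (root_refl root_sys ht hc).
  have h1 : c = t.
    have m1 : 0 <= m%:~R - 1 :> R by rewrite subr_ge0 -[1]/(1%:~R) ler_int; lia.
    have := coneD (cone_coroot ip rc0 h) (coneZ m1 (cone_coroot ip t0 ctt)).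
    by rewrite E scalerBl scale1r addrA subrK; apply: tmax.
  by rewrite h1 eqxx in ct.
have [m1|m2] : m = 1 \/ 1 < m by lia.
  by split=> //; rewrite m1.
(* Now m' = 1, so t^vee - c^vee is a coroot, necessarily a affpos one, and the
   coroot m t^vee - c^vee lies above the maximal coroot t^vee. *)
have m'1 : m' = 1 by nia.
have E' := coroot_refl ip t c0; rewrite -mE' m'1 scale1r in E'.
have hct := root_refl root_sys hc ht.
have ct0 := root_neq0 root_sys hct.
exfalso; have [h|h] := root_cone simple hct; last first.
  have h1 : c = t.
    apply: tmax => //; rewrite -opprB -E' -corootN.
    by apply: cone_coroot => //; rewrite oppr_eq0.
  by rewrite h1 eqxx in ct.
have /eqP : - refl t c = t.
  apply: tmax; first exact: (root_opp root_sys (root_refl root_sys ht hc)).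
  rewrite corootN E opprB.
  have -> : m%:~R *: coroot t - coroot c - coroot t =
            coroot (refl c t) + (m - 2)%:~R *: coroot t.
    rewrite E' rmorphB /= scalerBl -[2%:~R]/(2 : R) scaler_nat mulr2n opprD.
    by rewrite [_ *: _ + (_ + _)]addrA addrACA [coroot t + _]addrC subrK addrA.
  apply: coneD; first exact: cone_coroot.
  by apply: coneZ; [rewrite -[0]/(0%:~R) ler_int; lia|exact: cone_coroot].
rewrite eqr_oppLR -(refl_self ip t0) => /eqP /(can_inj (reflK ip t0)).
by move=> h1; rewrite h1 eqxx in ct.
Qed.

End AffineWeyl.

(** * Reflections in the walls of the base alcove *)

Section Walls.
Context {R : realType} {V : vectType R} (ip : {dot V for idfun}) (Phi : {fset V}).
Context {n : nat} (alpha : n.-tuple V).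
Hypothesis root_sys : root_system ip Phi.
Hypothesis simple : simple_system Phi alpha.
Local Notation coroot := (coroot ip).
Local Notation refl := (refl ip).
Local Notation al := (tnth alpha).
Local Notation cone := (cone alpha).
Local Notation aact := (affact ip).
Variable p : V.
Hypothesis p_dom : forall i, 0 < ip p (al i).
Hypothesis p_small : forall b, b \in Phi -> `|ip p (coroot b)| < 1.
Local Notation positive := (affpos ip p).
Implicit Types (a b c t x y : V) (f g h : V * int).

(* The affine functions alpha_i^vee and 1 - t^vee, with t^vee a maximal coroot,
   vanish on the walls of the base alcove. *)
Definition affine_simple f :=
  (exists i, f = (al i, 0)) \/
  (exists t : V, maximal_root ip Phi alpha t /\ f = (- t, 1)).

Lemma affine_simple_root f : affine_simple f -> f.1 \in Phi.
Proof.
case=> [[i ->]|[t [[ht _ _] ->]]] /=; first exact: (simple_root simple).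
exact: (root_opp root_sys ht).
Qed.

Lemma reflN a x : refl (- a) x = refl a x.
Proof. by rewrite /Defs.refl corootN ipNr scalerN scaleNr opprK. Qed.

Lemma reflNr a x : refl a (- x) = - refl a x.
Proof. by rewrite -scaleN1r reflZ scaleN1r. Qed.

(** This is the affine form of a simple reflection permuting the positive roots other than its own.
    An affine coroot is positive when its constant term is at least 1, or is 0 with positive linear
    part, so each case tracks these two data. *)
Lemma aact_affine_simple_positive f g :
  affine_simple g -> f.1 \in Phi -> positive f -> f <> g -> positive (aact g f).
Proof.
move=> sg hf pf fg; have hg := affine_simple_root sg.
have ha := aact_root root_sys hg hf.
have pge1 := positive_ge1 p_small ha.
have pcone := positive_cone root_sys simple p_dom p_small ha.
have fP := positiveP root_sys simple p_dom p_small hf pf.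
case: sg => [[i gE]|[t [tm gE]]]; rewrite gE /= in pge1 pcone fg *.
  rewrite mulr0 subr0 in pge1 pcone.
  case: fP => [[cf f2]|[_ f2]]; last exact: pge1.
  have [fi|fi] := eqVneq f.1 (al i); last first.
    exact/pcone/f2/(simple_refl_cone root_sys simple).
  apply: pge1; suff : f.2 != 0 by lia.
  by apply/eqP => f0; apply: fg; rewrite -fi -f0; case: (f).
rewrite reflN ipNl mulr1 in pge1 pcone.
case: (tm) => ht ct tmax.
have t0 := root_neq0 root_sys ht; have f0 := root_neq0 root_sys hf.
(* The constant term grows by [<t, f.1^vee>], which is nonnegative for a positive linear part; if it
   is zero, the reflection fixes [f.1]. *)
case: fP => [[cf f2]|[cf f2]].
  have /intrP[m mE] := root_int root_sys ht hf.
  have := maximal_root_dominant root_sys simple tm hf cf.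
  rewrite mE ler0z => m0; rewrite mE -rmorphN /= intrKfloor in pge1 pcone.
  have [m0'|m1] : m = 0 \/ 1 <= m by lia.
    apply: pcone; last by rewrite m0' oppr0 subr0.
    by rewrite refl_orthogonal// mE m0'.
  by apply: pge1; lia.
(* For a negative linear part the constant term drops by 2 if [f.1 = - t], where it was not 1
   because [f] is not [g]; otherwise it drops by at most 1, and only when the linear part becomes
   positive. *)
have [ft|ft] := eqVneq (- f.1) t.
  have f1E : f.1 = - t by rewrite -ft opprK.
  rewrite f1E corootN ipNr opprK (coroot_self ip t0) reflNr refl_self// opprK in pcone.
  apply: pcone => //; rewrite -[2]/(2%:~R) intrKfloor.
  suff : f.2 != 1 by lia.
  by apply/eqP => f21; apply: fg; rewrite -f1E -f21; case: (f).
rewrite -ipNr -corootN in pge1 pcone.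
have [h|[h1 h2]] := maximal_root_cartan root_sys simple tm (root_opp root_sys hf) cf ft.
  by apply: pge1; rewrite h -[0]/(0%:~R) intrKfloor subr0.
rewrite h1 -[1]/(1%:~R) intrKfloor in pcone; rewrite reflNr opprK in h2.
by apply: pcone => //; rewrite subr_ge0.
Qed.

End Walls.

(** * The affine Weyl group acts freely on alcoves *)

Section Freeness.
Context {R : realType} {V : vectType R} (ip : {dot V for idfun}) (Phi : {fset V}).
Context {n : nat} (alpha : n.-tuple V).
Hypothesis root_sys : root_system ip Phi.
Hypothesis simple : simple_system Phi alpha.
Local Notation coroot := (coroot ip).
Local Notation refl := (refl ip).
Local Notation al := (tnth alpha).
Local Notation cone := (cone alpha).
Local Notation aval := (affval ip).
Local Notation arefl := (affrefl ip).
Local Notation aact := (affact ip).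
Variable p : V.
Hypothesis p_dom : forall i, 0 < ip p (al i).
Hypothesis p_small : forall b, b \in Phi -> `|ip p (coroot b)| < 1.
Local Notation positive := (affpos ip p).
Local Notation affine_simple := (affine_simple ip Phi alpha).
Implicit Types (a b c x y : V) (f g h : V * int) (s t : seq (V * int)).

Definition word (s : seq (V * int)) : V -> V := foldr (fun f w => arefl f \o w) id s.

Lemma word_cat s t x : word (s ++ t) x = word s (word t x).
Proof. by elim: s => //= f s ->. Qed.

Definition simple_word s := forall f, f \in s -> affine_simple f.

Lemma simple_word_cat s t : simple_word s -> simple_word t -> simple_word (s ++ t).
Proof. by move=> hs ht f; rewrite mem_cat => /orP[/hs|/ht]. Qed.

Lemma simple_word1 f : affine_simple f -> simple_word [:: f].
Proof. by move=> hf g; rewrite inE => /eqP ->. Qed.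

(** A natural number stands in for the real [ip p b] as a termination measure. *)
Definition root_rank b := #|[pred c : Phi | ip p (val c) < ip p b]|.

Lemma root_rank_lt a b : a \in Phi -> ip p a < ip p b -> (root_rank a < root_rank b)%N.
Proof.
move=> ha ab; apply/proper_card/properP; split.
  by apply/fintype.subsetP => c; rewrite !inE => /lt_trans; apply.
by exists [` ha]%fset; rewrite !inE ?ltxx.
Qed.

(* Unless f is simple, some simple g makes aact g f a smaller positive affine
   coroot: either its constant term drops, or its linear part goes down. *)
Lemma positive_arefl_word f : f.1 \in Phi -> positive f ->
  exists2 s, simple_word s & arefl f =1 word s.
Proof.
have [k] := ubnP `|f.2|%N; elim: k f => // k IHk f fk.
have [r] := ubnP (root_rank f.1); elim: r f fk => // r IHr f fk fr hf pf.
have [sf|sf] := pselect (affine_simple f).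
  by exists [:: f] => //; apply: simple_word1.
suff [g [sg fg [s ss sE]]] : exists g, [/\ affine_simple g, f <> g &
    exists2 s, simple_word s & arefl (aact g f) =1 word s].
  have hg := affine_simple_root root_sys simple sg.
  (* The reflection of [f] is the conjugate by that of [g] of the reflection of [aact g f]. *)
  exists (g :: s ++ [:: g]).
    by apply: (simple_word_cat (simple_word1 sg)); apply/simple_word_cat/simple_word1.
  move=> x; rewrite /= word_cat -sE /= (arefl_aact root_sys)//.
  by rewrite !(areflK root_sys hg).
have step g : affine_simple g -> f <> g -> [/\ g.1 \in Phi, (aact g f).1 \in Phi,
    positive (aact g f) & 0 <= (aact g f).2].
  move=> sg fg; have hg := affine_simple_root root_sys simple sg.
  have ha := aact_root root_sys hg hf.
  have pa := aact_affine_simple_positive root_sys simple p_dom p_small sg hf pf fg.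
  by split=> //; case: (positiveP root_sys simple p_dom p_small ha pa); lia.
have f2 : 0 <= f.2.
  by case: (positiveP root_sys simple p_dom p_small hf pf); lia.
(* Reflecting in a simple root with [<f.1, al i>] positive keeps the constant term and lowers the
   rank. *)
have [[i fi]|nodesc] := pselect (exists i, 0 < ip f.1 (al i)).
  pose g := (al i, 0 : int); have sg : affine_simple g by left; exists i.
  have fg : f <> g by move=> fg; apply: sf; rewrite fg.
  have [hg ha pa a2] := step g sg fg; exists g; split=> //.
  apply: IHr => //; first by rewrite /= mulr0 subr0.
  apply: (leq_trans _ (fr : (_ <= r)%N)); apply: root_rank_lt => //=.
  rewrite /Defs.refl ipDr ipNr ipZr gtrDl oppr_lt0 pmulr_rgt0 ?coroot_ip_gt0//.
  exact: (root_neq0 root_sys hg).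
have f0 := root_neq0 root_sys hf.
have dom i : 0 <= ip (- f.1) (al i).
  by rewrite ipNl oppr_ge0 leNgt; apply/negP => h; apply: nodesc; exists i.
have cf : cone (- f.1).
  have [h|//] := root_cone simple hf.
  have := cone_ip_ge0 simple dom h; rewrite ipNl oppr_ge0 leNgt.
  by rewrite ip_gt0.
have f2' : 1 <= f.2.
  case: (positiveP root_sys simple p_dom p_small hf pf) => -[h] //.
  by move: f0; rewrite (cone_antisym simple h cf) eqxx.
(* Now [- f.1] is positive and dominant, so it pairs positively with a maximal coroot [t^vee] above
   its own coroot. Hence the reflection of [(- t, 1)] lowers the constant term. *)
have [t [tm ct]] := maximal_root_exists root_sys simple p_dom (root_opp root_sys hf) cf.
pose g := (- t, 1 : int); have sg : affine_simple g by right; exists t.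
have fg : f <> g by move=> fg; apply: sf; rewrite fg.
have [hg ha pa a2] := step g sg fg; exists g; split=> //.
apply: IHk => //; move: a2; rewrite /= mulr1.
set m := Num.floor _; suff : 0 < m by lia.
rewrite -(ltr_int R) /= floorK ?(root_int root_sys hg hf)//.
case: tm => ht _ _; have t0 := root_neq0 root_sys ht.
rewrite ipNl -ipNr -corootN coroot_ip_gt0 ?oppr_eq0// ipC.
rewrite -(coroot_ip_gt0 ip _ t0).
have := cone_ip_ge0 simple dom ct; rewrite ipDr ipNr subr_ge0; apply: lt_le_trans.
by rewrite coroot_ip_gt0 ?ip_gt0 ?oppr_eq0.
Qed.

Lemma arefl_word f : f.1 \in Phi ->
  exists2 s, simple_word s & arefl f =1 word s.
Proof.
move=> hf; case: (boolP (positive f)) => [|np]; first exact: positive_arefl_word.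
have oE x : aval (- f.1, - f.2) x = - aval f x.
  by rewrite /affval corootN ipNr rmorphN opprD.
have [||s ss sE] := @positive_arefl_word (- f.1, - f.2).
- exact: (root_opp root_sys hf).
- by rewrite /affpos oE oppr_gt0 (positive_or_neg root_sys simple p_dom p_small).
by exists s => // x; rewrite -sE /affrefl oE scalerN scaleNr opprK.
Qed.

Lemma affine_weyl_word w : affine_weyl ip Phi w ->
  exists2 s, simple_word s & w = word s.
Proof.
elim=> [|a k v ha _ [s ss ->]]; first by exists [::].
have [t tt tE] := @arefl_word (a, - k) ha.
exists (t ++ s); first exact: simple_word_cat.
by apply/funext => x; rewrite word_cat -tE (arefl_aff ip (a, - k)) /= opprK.
Qed.

Lemma word_root s f : simple_word s -> f.1 \in Phi -> exists2 g, g.1 \in Phi &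
  forall x, aval f (word s x) = aval g x /\ arefl f (word s x) = word s (arefl g x).
Proof.
elim: s f => [|h s IHs] f hs hf; first by exists f.
have hh : h.1 \in Phi.
  by apply: (affine_simple_root root_sys simple); apply: hs; rewrite inE eqxx.
have [||g hg gE] := IHs (aact h f); last 1 first.
- exists g => // x; rewrite /=; case: (gE x) => <- <-; split; first exact: (aval_arefl root_sys).
  by rewrite /= (arefl_aact root_sys)// (areflK root_sys hh).
- by move=> u us; apply: hs; rewrite inE us orbT.
exact: aact_root.
Qed.

(** Let [h] be the pullback of [g] along [s] without its last letter [f]. If [h] is already negative
    at [p], the prefix can be shortened by induction. Otherwise [f] alone makes [h] negative, which
    forces [h = f], and then the reflection in [g] cancels that last letter. *)
Lemma exchange g s : affine_simple g -> simple_word s -> aval g (word s p) < 0 ->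
  exists s', [/\ simple_word s', (size s' < size s)%N & arefl g \o word s =1 word s'].
Proof.
move=> sg; elim/last_ind: s => [|s f IHs] hs.
  rewrite /= ltNge; suff : positive g by move/ltW => ->.
  case: sg => [[i ->]|[t [[ht ct tmax] ->]]].
    apply: (positive_cone root_sys simple p_dom p_small) => //=.
    - exact: (simple_root simple).
    - exact: (cone_simple simple).
  by apply: (positive_ge1 p_small) => //=; apply: (root_opp root_sys).
have hs' : simple_word s by move=> u us; apply: hs; rewrite mem_rcons inE us orbT.
have sf : affine_simple f by apply: hs; rewrite mem_rcons inE eqxx.
have hf := affine_simple_root root_sys simple sf.
have hg := affine_simple_root root_sys simple sg.
have [h hh hE] := word_root hs' hg.
have [neg|pos] := boolP (aval g (word s p) < 0).
  have [s' [ss' lt sE]] := IHs hs' neg.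
  move=> _; exists (rcons s' f); split; last first.
    by move=> x; rewrite /= -!cats1 !word_cat /= -sE.
  - by rewrite !size_rcons.
  - by rewrite -cats1; apply/simple_word_cat/simple_word1.
rewrite -cats1 word_cat /= (hE _).1 (aval_arefl root_sys)// => neg.
have ph : positive h.
  by apply: contraR pos => /(positive_or_neg root_sys simple p_dom p_small hh); rewrite (hE _).1.
have hfE : h = f.
  apply: contrapT => hf'.
  have := aact_affine_simple_positive root_sys simple p_dom p_small sf hh ph hf'.
  by rewrite /affpos ltNge ltW.
exists s; split=> //; first by rewrite size_cat addn1.
by move=> x; rewrite /= word_cat /= (hE _).2 hfE (areflK root_sys hf).
Qed.

(** If a word starting with [g] keeps [g] positive, its tail makes [g] negative, so the exchange
    condition yields a shorter word for the same map. *)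
Lemma simple_word_fix s : simple_word s ->
  (forall g, affine_simple g -> 0 < aval g (word s p)) -> word s =1 id.
Proof.
have [k] := ubnP (size s); elim: k s => // k IHk [|g s] // sk hs pos.
have sg : affine_simple g by apply: hs; rewrite inE eqxx.
have hg := affine_simple_root root_sys simple sg.
have hs' : simple_word s by move=> u us; apply: hs; rewrite inE us orbT.
have [|s' [ss' lt sE]] := exchange sg hs'.
  by have := pos g sg; rewrite /= (aval_arefl_self root_sys)// oppr_gt0.
have wE : word (g :: s) =1 word s' by [].
move=> x; rewrite wE; apply: IHk => //; first by apply: leq_trans lt _; apply: ltnW sk.
by move=> h /pos; rewrite wE.
Qed.

(** The second hypothesis says that no hyperplane separates [w p] from [p]. *)
Lemma affine_weyl_free w : affine_weyl ip Phi w ->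
  (forall f, f.1 \in Phi -> positive f -> 0 < aval f (w p)) -> w = id.
Proof.
move=> /affine_weyl_word[s ss ->] pos; apply/funext/simple_word_fix => // g sg.
apply: pos; first exact: affine_simple_root sg.
case: sg => [[i ->]|[t [[ht ct tmax] ->]]].
  apply: (positive_cone root_sys simple p_dom p_small) => //=.
  - exact: (simple_root simple).
  - exact: (cone_simple simple).
by apply: (positive_ge1 p_small) => //=; apply: (root_opp root_sys).
Qed.

End Freeness.

(** * Shi vectors *)

Section AffineGroup.
Context {R : realType} {V : vectType R} (ip : {dot V for idfun}) (Phi : {fset V}).
Hypothesis root_sys : root_system ip Phi.
Local Notation coroot := (coroot ip).
Implicit Types (x y a : V) (u v w : V -> V).

Lemma affine_weyl_comp u v : affine_weyl ip Phi u -> affine_weyl ip Phi v ->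
  affine_weyl ip Phi (u \o v).
Proof.
move=> hu hv; elim: hu => [//|a k w ha _ IH].
exact: (affine_weyl_refl k ha IH).
Qed.

Lemma affine_weyl_inv w : affine_weyl ip Phi w ->
  exists w', [/\ affine_weyl ip Phi w', cancel w w' & cancel w' w].
Proof.
elim=> [|a k v ha _ [v' [hv' vK v'K]]]; first by exists id; split=> //; apply: affine_weyl_id.
have rK : involutive (aff_refl ip a k).
  by rewrite -[k]opprK -(arefl_aff ip (a, - k)); apply: areflK root_sys _ _.
exists (v' \o aff_refl ip a k); split.
- exact: affine_weyl_comp hv' (affine_weyl_refl k ha (affine_weyl_id _ _)).
- by move=> x; rewrite /= rK vK.
- by move=> x; rewrite /= v'K rK.
Qed.

Lemma translationD x y : translation (x + y) = translation y \o translation x.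
Proof. by apply/funext => v; rewrite /translation /= addrA. Qed.

Lemma translation0 : translation (0 : V) = id.
Proof. by apply/funext => v; rewrite /translation addr0. Qed.

(** The reflections in two adjacent parallel hyperplanes compose to the translation. *)
Lemma affine_weyl_root_translation a : a \in Phi -> affine_weyl ip Phi (translation a).
Proof.
move=> ha; have a0 := root_neq0 root_sys ha.
suff -> : translation a = aff_refl ip a 1 \o (aff_refl ip a 0 \o id).
  by do 2! apply: affine_weyl_refl => //; apply: affine_weyl_id.
apply/funext => v; rewrite /= /translation /aff_refl subr0 ipDr ipNr ipZr.
rewrite -addrA -opprD -scalerDl (ipC ip (coroot a) a) coroot_self//.
by rewrite [X in X *: _](_ : _ = -1) ?scaleN1r ?opprK//; ring.
Qed.

Lemma affine_weyl_translation x : root_lattice Phi x -> affine_weyl ip Phi (translation x).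
Proof.
case=> c ->; pose P (y : V) := affine_weyl ip Phi (translation y).
have PD y z : P y -> P z -> P (y + z).
  by rewrite /P translationD => hy hz; apply: affine_weyl_comp.
have P0 : P 0 by rewrite /P translation0; apply: affine_weyl_id.
apply: (big_ind P) => // i _.
have hi : (in_tuple Phi)`_i \in Phi by rewrite mem_nth.
have PM a m : a \in Phi -> P (a *+ m).
  by move=> ha; elim: m => // m; rewrite mulrS; apply: PD; apply: affine_weyl_root_translation.
case: (c i) => m; first by rewrite -pmulrn; apply: PM.
by rewrite NegzE mulrNz -mulNrz -pmulrn; apply/PM/(root_opp root_sys).
Qed.

End AffineGroup.

(** * Alcoves as intersections of strips *)

Section ShiVectors.
Context {R : realType} {V : vectType R} (ip : {dot V for idfun}) (Phi : {fset V}).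
Context {n : nat} (alpha : n.-tuple V).
Hypothesis root_sys : root_system ip Phi.
Hypothesis simple : simple_system Phi alpha.
Local Notation coroot := (coroot ip).
Local Notation al := (tnth alpha).
Local Notation cone := (cone alpha).
Local Notation aval := (affval ip).
Local Notation pos_roots := (pos_roots Phi alpha).
Variable p : V.
Hypothesis p_dom : forall i, 0 < ip p (al i).
Hypothesis p_small : forall b, b \in Phi -> `|ip p (coroot b)| < 1.
Implicit Types (x y : V) (f g : V * int) (w : V -> V) (k : {ffun pos_roots -> int}).

Lemma pos_rootsP b : reflect (b \in Phi /\ cone b) (b \in pos_roots).
Proof.
rewrite !inE /=; apply: (iffP andP) => -[hb cb]; split=> //.
  by move=> i; have /forallP := cb; apply.
by apply/forallP.
Qed.

Definition strips k : set V := (\bigcap_(b : pos_roots) strip ip (val b) (k b))%classic.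

(** For a negative root the strip at level [k] of the opposite root becomes the one at level
    [- k - 1], whence the shift in the second witness. *)
Lemma strips_val k f : f.1 \in Phi -> exists m : int,
  forall y, strips k y -> m%:~R < aval f y < m%:~R + 1.
Proof.
move=> hf; have [cf|cf] := root_cone simple hf.
  have fpos : f.1 \in pos_roots by apply/pos_rootsP.
  exists (k [` fpos]%fset + f.2) => y /(_ [` fpos]%fset I); rewrite /strip /= /affval.
  by rewrite rmorphD /=; lra.
have hf' := root_opp root_sys hf.
have fpos : - f.1 \in pos_roots by apply/pos_rootsP.
exists (- k [` fpos]%fset - 1 + f.2) => y /(_ [` fpos]%fset I); rewrite /strip /= /affval.
by rewrite corootN ipNr !(rmorphD, rmorphN) /=; lra.
Qed.

Lemma int_strip_unique (t : R) (m m' : int) :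
  m%:~R < t < m%:~R + 1 -> m'%:~R < t < m'%:~R + 1 -> m = m'.
Proof.
move=> /andP[h1 h2] /andP[h3 h4].
have : m%:~R < (m' + 1)%:~R :> R by rewrite rmorphD /=; lra.
have : m'%:~R < (m + 1)%:~R :> R by rewrite rmorphD /=; lra.
by rewrite !ltr_int; lia.
Qed.

Lemma base_alcove_p : base_alcove ip Phi alpha p.
Proof.
move=> b _; rewrite /strip /= add0r.
have /pos_rootsP[hb cb] := valP b.
have [[_ //]|[cb' _]] := root_ip_p root_sys simple p_dom p_small hb.
by have := root_neq0 root_sys hb; rewrite (cone_antisym simple cb cb') eqxx.
Qed.

Lemma alcove_strips w : affine_weyl ip Phi w -> exists k, alcove ip Phi alpha w = strips k.
Proof.
move=> hw; have [w' [hw' wK w'K]] := affine_weyl_inv root_sys hw.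
have rt v f : affine_weyl ip Phi v -> f.1 \in Phi ->
    exists2 g, g.1 \in Phi & forall x, aval f (v x) = aval g x.
  move=> /(affine_weyl_word root_sys simple p_dom p_small)[s ss ->] hf.
  by have [g hg gE] := word_root root_sys simple ss hf; exists g => // x; case: (gE x).
have baseE : base_alcove ip Phi alpha = strips [ffun=> 0].
  by apply: eq_bigcap => // b _; rewrite ffunE.
(* The pullback of [b] by [w] is an affine coroot, whose values on the base alcove stay in one unit
   strip; the level of that strip is the entry at [b]. *)
have /fin_all_exists[k kP] (b : pos_roots) : exists m : int, forall x,
    base_alcove ip Phi alpha x -> strip ip (val b) m (w x).
  have /pos_rootsP[hb cb] := valP b.
  have [g hg gE] := rt w (val b, 0) hw hb.
  have [m mP] := strips_val [ffun=> 0] hg; exists m => x; rewrite baseE => /mP.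
  by rewrite -gE /affval /= addr0.
have wk x : base_alcove ip Phi alpha x -> strips (finfun k) (w x).
  by move=> hx b _; rewrite ffunE; apply: kP.
exists (finfun k); apply/seteqP; split=> [_ [x hx <-]|y hy]; first exact: wk.
exists (w' y) => // b _; have /pos_rootsP[hb cb] := valP b.
have [g hg gE] := rt w' (val b, 0) hw' hb.
(* The pullback of [b] by the inverse [w'] takes values in one unit strip at [y] and at [w p]; as
   [w'] sends [w p] back to [p], the level is 0. *)
have [m mP] := strips_val (finfun k) hg.
have := mP _ hy; have := mP _ (wk _ base_alcove_p).
rewrite -!gE wK {1 2}/affval /= addr0 => /int_strip_unique.
have : strip ip (val b) 0 p by apply: base_alcove_p.
rewrite /strip /= => h /(_ _ h) ->.
by rewrite /affval /= addr0.
Qed.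

(** Since the alcove of [w] is an intersection of strips, the choice in [shi_vector] does not fall
    back to its default. *)
Lemma shi_vectorP w : affine_weyl ip Phi w -> strips (shi_vector ip Phi alpha w) (w p).
Proof.
move=> /alcove_strips/(xgetPex 0) /= wE; rewrite /strips -[X in X _]wE.
by exists p => //; apply: base_alcove_p.
Qed.

End ShiVectors.

(** * Offsets along a component of the Shi variety *)

Section Component.
Context {R : realType} {V : vectType R} (ip : {dot V for idfun}) (Phi : {fset V}).
Context {n : nat} (alpha : n.-tuple V).
Hypothesis root_sys : root_system ip Phi.
Hypothesis simple : simple_system Phi alpha.
Local Notation al := (tnth alpha).
Local Notation pos_roots := (pos_roots Phi alpha).

Lemma simple_pos i : al i \in pos_roots.
Proof.
apply/pos_rootsP; split; [exact: (simple_root simple)|exact: (cone_simple simple)].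
Qed.

Lemma entry_in (T : nmodType) (x : {ffun pos_roots -> T}) a (ha : a \in pos_roots) :
  entry x a = x [` ha]%fset.
Proof. by rewrite /entry insubT. Qed.

(** On the piece of the variety given by [l] this is the constant [l b]. *)
Definition offset (b : pos_roots) (x : {ffun pos_roots -> R}) : R :=
  x b - \sum_i coroot_coef ip alpha (val b) i * entry x (al i).

Definition offset_poly (b : pos_roots) : {mpoly R[#|{: pos_roots}|]} :=
  'X_(enum_rank b) - \sum_i (coroot_coef ip alpha (val b) i)%:MP *
    'X_(enum_rank [` simple_pos i]%fset).

Lemma offset_polyE b (x : {ffun pos_roots -> R}) :
  (offset_poly b).@[fun i => x (enum_val i)] = offset b x.
Proof.
rewrite /offset_poly /offset mevalB mevalXU enum_rankK; congr (_ - _).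
rewrite raddf_sum; apply: eq_bigr => i _.
by rewrite /= mevalM mevalC mevalXU enum_rankK (entry_in _ (simple_pos i)).
Qed.

(* Each offset takes finitely many values on the Shi variety, so it separates
   points of distinct values by polynomial equations. *)
Lemma component_offset Z x y b :
  irreducible_component (shi_variety ip Phi alpha) Z -> Z x -> Z y ->
  offset b x = offset b y.
Proof.
case=> ZX [_ irr] _ Zx Zy.
have offZ z : Z z -> exists2 l : int, offset b z = l%:~R &
    0 <= l /\ l%:~R <= height ip alpha (val b) - 1.
  move=> /ZX[l [adm _] zl]; exists (l b); last exact: adm.
  by rewrite /offset zl addrAC subrr add0r.
pose N := `|Num.floor (height ip alpha (val b))|%N.
have offN z : Z z -> exists2 j, offset b z = j%:R & (j < N.+1)%N.
  move=> /offZ[l zl [l0 lh]]; exists `|l|%N; first by rewrite zl natr_absz ger0_norm.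
  have : l <= Num.floor (height ip alpha (val b)) by rewrite floor_ge_int; lra.
  by rewrite /N; lia.
have [jx xj jxN] := offN x Zx.
(* [F] holds the points whose offset is that of [x], and [G] those with another value from 0 to [N].
   They cover [Z], and [x] is not in [G], so irreducibility puts [Z] inside [F]. *)
pose F := vanishing [set offset_poly b - jx%:R%:MP]%classic.
pose q := \prod_(j < N.+1 | j != jx :> nat) (offset_poly b - (j : nat)%:R%:MP).
pose G := vanishing [set q]%classic.
have FP z : F z <-> offset b z = jx%:R.
  rewrite -offset_polyE; split=> [/(_ _ erefl)/eqP|zE _ ->].
    by rewrite mevalB mevalC subr_eq0 => /eqP.
  by rewrite mevalB mevalC zE subrr.
have GP z : G z <-> \prod_(j < N.+1 | j != jx :> nat) (offset b z - (j : nat)%:R) = 0.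
  have E : \prod_(j < N.+1 | j != jx :> nat) (offset b z - (j : nat)%:R) =
      q.@[fun i => z (enum_val i)].
    rewrite /q rmorph_prod; apply: eq_bigr => j _.
    by rewrite /= mevalB mevalC offset_polyE.
  by rewrite E; split=> [/(_ _ erefl)//|zE _ ->].
have cF : zariski_closed F by eexists.
have cG : zariski_closed G by eexists.
have [|ZF|ZG] := irr F G cF cG.
- move=> z Zz; have [j zj jN] := offN z Zz.
  have [jE|jN'] := eqVneq j jx; first by left; apply/FP; rewrite zj jE.
  right; apply/GP; rewrite (bigD1 (Ordinal jN))//= zj subrr mul0r//.
- by rewrite xj; apply/esym/FP/ZF.
have /GP/eqP := ZG _ Zx; rewrite xj => /prodf_eq0[j jn].
by rewrite subr_eq0 eqr_nat eq_sym (negPf jn).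
Qed.

End Component.

(** * Same orientation and the image of the Cartan matrix *)

Section Orientation.
Context {R : realType} {V : vectType R} (ip : {dot V for idfun}) (Phi : {fset V}).
Context {n : nat} (alpha : n.-tuple V).
Hypothesis root_sys : root_system ip Phi.
Hypothesis simple : simple_system Phi alpha.
Local Notation coroot := (coroot ip).
Local Notation al := (tnth alpha).
Implicit Types (x y : V) (w : V -> V).

Lemma root_latticeP x :
  root_lattice Phi x <-> exists m : 'I_n -> int, x = \sum_i al i *~ m i.
Proof.
split=> [[c ->]|[m ->]].
  pose P y := exists m : 'I_n -> int, y = \sum_i al i *~ m i.
  have P0 : P 0 by exists (fun=> 0); rewrite big1.
  have PD y z : P y -> P z -> P (y + z).
    move=> [m ->] [l ->]; exists (fun i => m i + l i).
    by rewrite -big_split; apply: eq_bigr => i _; rewrite mulrzDr.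
  apply: (big_ind P) => // i _.
  have hi : (in_tuple Phi)`_i \in Phi by rewrite mem_nth.
  case: simple => _ _ /(_ _ hi)[a [aE|aE]]; rewrite aE.
    exists (fun j => (a j)%:Z * c i); rewrite mulrz_suml.
    by apply: eq_bigr => j _; rewrite mulrzA -pmulrn.
  exists (fun j => - ((a j)%:Z * c i)); rewrite mulNrz mulrz_suml -sumrN.
  by apply: eq_bigr => j _; rewrite mulrNz mulrzA -pmulrn.
have P0 : root_lattice Phi 0 by exists 0; rewrite big1// => i _; rewrite ffunE.
have PD y z : root_lattice Phi y -> root_lattice Phi z -> root_lattice Phi (y + z).
  move=> [a ->] [b ->]; exists (a + b); rewrite -big_split.
  by apply: eq_bigr => i _; rewrite ffunE mulrzDr.
apply: (big_ind (root_lattice Phi)) => // i _.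
have hi := simple_root simple i; have hn : (index (al i) Phi < size Phi)%N by rewrite index_mem.
exists [ffun j => if j == Ordinal hn then m i else 0].
rewrite (bigD1 (Ordinal hn))//= ffunE eqxx nth_index// big1 ?addr0// => j jn.
by rewrite ffunE (negPf jn).
Qed.

(** The simple coroots are nonzero multiples of the simple roots, hence also a basis. *)
Lemma coroot_decomp b : coroot b = \sum_i coroot_coef ip alpha b i *: coroot (al i).
Proof.
set ca := map_tuple coroot alpha.
have caE (i : 'I_n) : ca`_i = coroot (al i).
  by rewrite -tnth_nth tnth_map.
have bs : basis_of fullv ca.
  rewrite basisEdim; apply/andP; split.
    apply/subvP => v _; rewrite (simple_decomp simple v); apply: memv_suml => i _.
    have a0 := root_neq0 root_sys (simple_root simple i).
    rewrite memvZ// -[al i](corootK ip a0) {1}/Defs.coroot memvZ//.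
    by apply: memv_span; apply/mapP; exists (al i) => //; apply: mem_tnth.
  by case: simple => /vector.size_basis dimn _ _; rewrite size_tuple dimn.
rewrite (coord_basis bs (memvf (coroot b))); apply: eq_bigr => i _.
by rewrite caE.
Qed.

Variables (w w' : V -> V).
Hypotheses (Hw : affine_weyl ip Phi w) (Hw' : affine_weyl ip Phi w').
Local Notation k i := (shi_coef ip Phi alpha w (al i)).
Local Notation k' i := (shi_coef ip Phi alpha w' (al i)).

Lemma same_orientation_iff :
  (exists Z, [/\ irreducible_component (shi_variety ip Phi alpha) Z,
          Z (shi_point ip Phi alpha w) & Z (shi_point ip Phi alpha w')]) ->
  same_orientation Phi w w' <-> exists m : 'I_n -> int, forall j,
    (k' j - k j)%:~R = \sum_i (m i)%:~R * ip (al i) (coroot (al j)) :> R.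
Proof.
move=> [Z [cZ Zw Zw']].
have [p [p_dom p_small]] := base_point_exists ip simple.
have sw := shi_vectorP root_sys simple p_dom p_small Hw.
have sw' := shi_vectorP root_sys simple p_dom p_small Hw'.
have ipx (m : 'I_n -> int) j : ip (\sum_i al i *~ m i) (coroot (al j)) =
    \sum_i (m i)%:~R * ip (al i) (coroot (al j)).
  by rewrite ip_suml; apply: eq_bigr => i _; rewrite -scaler_int ipZl.
split=> [[x [/root_latticeP[m xE] w'E]]|[m mE]].
  exists m => j; rewrite -ipx -xE; have hj := simple_root simple j.
  have /intrP[z zE] : ip x (coroot (al j)) \is a Num.int.
    rewrite xE ipx rpred_sum// => i _; rewrite rpredM ?intr_int//.
    exact: (root_int root_sys (simple_root simple i)).
  rewrite /shi_coef !(entry_in _ (simple_pos simple j)).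
  set b := [` _]%fset.
  have := sw b I; have := sw' b I; rewrite /strip /= w'E /translation /= ipDl zE.
  move=> h1 h2; congr (_%:~R); apply/eqP; rewrite subr_eq addrC; apply/eqP.
  by apply: (int_strip_unique h1); rewrite rmorphD /=; lra.
pose u := translation (\sum_i al i *~ m i) \o w.
have xL : root_lattice Phi (\sum_i al i *~ m i) by apply/root_latticeP; exists m.
have hu : affine_weyl ip Phi u.
  by apply: affine_weyl_comp => //; apply: affine_weyl_translation.
exists (\sum_i al i *~ m i); split=> //.
(* Equal offsets make the difference of the two Shi vectors linear in its simple entries, so at
   every positive root it is the pairing with the translation vector. *)
have su : strips ip (shi_vector ip Phi alpha w') (u p).
  move=> b _; have := sw b I; rewrite /strip /u /translation /= ipDl.
  have := component_offset simple b cZ Zw Zw'; rewrite /offset !ffunE => bE.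
  have -> : ip (\sum_i al i *~ m i) (coroot (val b)) =
      (shi_vector ip Phi alpha w' b)%:~R - (shi_vector ip Phi alpha w b)%:~R.
    rewrite coroot_decomp ip_sumr.
    under eq_bigr => j _ do rewrite ipZr ipx -mE rmorphB /= mulrBr.
    rewrite sumrB.
    have E v : \sum_i coroot_coef ip alpha (val b) i * (shi_coef ip Phi alpha v (al i))%:~R =
      \sum_i coroot_coef ip alpha (val b) i * entry (shi_point ip Phi alpha v) (al i).
      apply: eq_bigr => i _.
      by rewrite /shi_coef !(entry_in _ (simple_pos simple i)) ffunE.
    by rewrite !E; lra.
  by lra.
have [v [hv w'K vK]] := affine_weyl_inv root_sys Hw'.
(* Both [w' p] and [u p] lie in the strips of [w'], so no hyperplane separates [p] from [v (u p)]
   and freeness applies to [v \o u]. *)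
suff vu : v \o u = id.
  by apply/funext => y; rewrite -[LHS](congr1 w' (congr1 (@^~ y) vu)) /= vK.
apply: (affine_weyl_free root_sys simple p_dom p_small).
  exact: affine_weyl_comp.
move=> f hf pf.
have [s ss sE] := affine_weyl_word root_sys simple p_dom p_small hv.
have [g hg gE] := word_root root_sys simple ss hf.
have [l lP] := strips_val root_sys simple (shi_vector ip Phi alpha w') hg.
rewrite /= sE (gE _).1.
have h1 := lP _ su; have := lP _ sw'.
rewrite -(gE _).1 -sE w'K => h2.
(* At [w' p] the function [g] takes the positive value of [f] at [p], so its strip, which also
   contains the value at [u p], has nonnegative level. *)
have : 0 <= l.
  by rewrite -ltzD1 -(ltr_int R) rmorphD /=; move: pf; rewrite /affpos; lra.
by rewrite -(ler_int R); lra.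
Qed.

End Orientation.

(** * Lattices spanned by Cartan matrices *)

Section Congruences.
Implicit Types (d f : nat -> int) (n j : nat).

Lemma eqz_modP (a b : int) (N : int) : (a = b %[mod N])%Z <-> exists q, b - a = q * N.
Proof.
rewrite (rwP eqP) eq_sym eqz_mod_dvd; split=> [/dvdzP//|]; by move/dvdzP.
Qed.

(** The zeros at 0 and [n + 1] stand for the missing neighbours at the ends of the diagram. *)
Definition supported n f := forall i, ~~ (0 < i <= n)%N -> f i = 0.

Definition psum d j : int := \sum_(1 <= i < j) d i.
Definition wsum d j : int := \sum_(1 <= i < j) i%:Z * d i.
(** This is the sum of [(j - i) d_i] over [1 <= i < j], whose second difference is [d]. *)
Definition dsum d j : int := j%:Z * psum d j - wsum d j.

Lemma psumS d j : psum d j.+2 = psum d j.+1 + d j.+1.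
Proof. by rewrite /psum big_nat_recr. Qed.

Lemma wsumS d j : wsum d j.+2 = wsum d j.+1 + j.+1%:Z * d j.+1.
Proof. by rewrite /wsum big_nat_recr. Qed.

Lemma dsum0 d : dsum d 0 = 0.
Proof. by rewrite /dsum /wsum big_geq// mul0r subr0. Qed.

Lemma dsumS d j : dsum d j.+1 = dsum d j + psum d j.+1.
Proof.
case: j => [|j]; last by rewrite /dsum psumS wsumS; lia.
by rewrite dsum0 /dsum /wsum /psum !big_geq//.
Qed.

(* The recurrence is that of the Cartan matrix along a simply laced chain. *)
Lemma chain_sol d f r : f 0 = 0 ->
  (forall j, (0 < j < r)%N -> d j = 2 * f j - f j.-1 - f j.+1) ->
  forall j, (j <= r)%N -> f j = j%:Z * f 1 - dsum d j.
Proof.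
move=> f0 fE j jr.
(* The recurrence has order two, so the induction carries two consecutive values. *)
suff [] : f j = j%:Z * f 1 - dsum d j /\
  ((j < r)%N -> f j.+1 = j.+1%:Z * f 1 - dsum d j.+1) by [].
elim: j jr => [|j IH] jr.
  split=> [|_]; first by rewrite f0 dsum0 mul0r subr0.
  by rewrite dsumS dsum0 /psum big_geq// addr0 mul1r.
have [IH1 IH2] := IH (ltnW jr); have {}IH2 := IH2 jr.
split=> // jr'; have := fE j.+1 jr'; rewrite /= IH1 IH2 !dsumS psumS; lia.
Qed.

(** Every slope [t] solves the chain equations, which leaves it free for the end of the diagram. *)
Lemma sol_chain d t j :
  d j.+1 = 2 * (j.+1%:Z * t - dsum d j.+1) - (j%:Z * t - dsum d j)
           - (j.+2%:Z * t - dsum d j.+2).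
Proof. by rewrite !dsumS psumS; lia. Qed.

(** Each [i] is its parity plus twice [i./2]. *)
Lemma wsum_odd d n :
  exists q : int, wsum d n = \sum_(1 <= i < n | odd i) d i + 2 * q.
Proof.
exists (\sum_(1 <= i < n) (i./2)%:Z * d i); rewrite /wsum [in RHS]big_mkcond mulr_sumr -big_split.
apply: eq_bigr => i _ /=; rewrite -{1}(odd_double_half i) -muln2.
by case: (odd i); lia.
Qed.

(** The end condition [f (n + 1) = 0] reads [(n + 1) f 1 = (n + 1) psum d (n + 1) - wsum d (n +
    1)]. *)
Lemma chain_A d n :
  (exists f, supported n f /\
    forall j, (0 < j <= n)%N -> d j = 2 * f j - f j.-1 - f j.+1) <->
  exists q, wsum d n.+1 = q * n.+1%:Z.
Proof.
split=> [[f [sf fE]]|[q qE]].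
  have := @chain_sol d f n.+1 (sf 0 isT) fE n.+1 (leqnn _).
  rewrite sf ?ltnn ?andbF// /dsum => h; exists (psum d n.+1 - f 1); lia.
pose t := psum d n.+1 - q; pose f j := if (0 < j <= n)%N then j%:Z * t - dsum d j else 0.
exists f; split=> [i /negPf|]; first by rewrite /f => ->.
have fE j : (j <= n.+1)%N -> f j = j%:Z * t - dsum d j.
  rewrite /f; case: j => [|j]; first by rewrite dsum0 mul0r subr0.
  rewrite /= ltnS leq_eqVlt => /orP[/eqP ->|->//].
  by rewrite ltnn /t /dsum; lia.
by case=> // j; rewrite ltnS => jn; rewrite /= !fE; try lia; exact: sol_chain.
Qed.

(** The chain leaves [f 1] free, and the last equation is [d n = 2 (f n - f (n - 1))]; the slope [t]
    makes that last difference equal to [q]. *)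
Lemma chain_B d n : (2 <= n)%N ->
  (exists f, supported n f /\
    forall j, (0 < j <= n)%N ->
      d j = 2 * f j - (if j == n then 2 else 1) * f j.-1 - f j.+1) <->
  exists q, d n = q * 2.
Proof.
case: n => [//|[//|n]] _; split=> [[f [sf fE]]|[q qE]].
  have sol := @chain_sol d f n.+2 (sf 0 isT).
  have {}sol : forall j, (j <= n.+2)%N -> f j = j%:Z * f 1 - dsum d j.
    by apply: sol => j /andP[j0 jn]; rewrite fE ?j0 1?ltnW//= ltn_eqF// mul1r.
  exists (f n.+2 - f n.+1); rewrite fE ?leqnn//= eqxx (sf n.+3) ?ltnn ?andbF//; lia.
pose t := q + psum d n.+2.
pose f j := if (0 < j <= n.+2)%N then j%:Z * t - dsum d j else 0.
exists f; split=> [i /negPf|]; first by rewrite /f => ->.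
have fE j : (j <= n.+2)%N -> f j = j%:Z * t - dsum d j.
  by rewrite /f; case: j => [|j /= ->//]; rewrite dsum0 mul0r subr0.
case=> // j /= jn; rewrite eqSS; have [->|jN] := eqVneq j n.+1.
  have -> : f n.+3 = 0 by rewrite /f ltnn andbF.
  by rewrite !fE// !dsumS qE /t; lia.
by rewrite mul1r !fE; try lia; exact: sol_chain.
Qed.

(** Doubling the last entry gives a simply laced chain [g] with [g n = 2 f n]. The last equation
    fixes its slope and yields [g n = wsum d (n + 1)], so the parity of this sum decides, and modulo
    2 only odd indices contribute. *)
Lemma chain_C d n : (2 <= n)%N ->
  (exists f, supported n f /\
    forall j, (0 < j <= n)%N ->
      d j = 2 * f j - f j.-1 - (if j.+1 == n then 2 else 1) * f j.+1) <->
  exists q, \sum_(1 <= j < n.+1 | odd j) d j = q * 2.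
Proof.
have [r rE] := wsum_odd d n.+1.
case: n => [//|[//|n]] in rE * => _; split=> [[f [sf fE]]|[q qE]].
  pose g j : int := if j == n.+2 then 2 * f j else f j.
  have sol : forall j, (j <= n.+2)%N -> g j = j%:Z * g 1 - dsum d j.
    apply: chain_sol => [|j /andP[j0 jn]]; first exact: sf.
    have jP : (j.-1 == n.+2) = false by lia.
    rewrite fE ?j0 1?ltnW//= /g jP (ltn_eqF jn).
    by case: eqP => _; lia.
  have gn2 : g n.+2 = 2 * f n.+2 by rewrite /g eqxx.
  have gn1 : g n.+1 = f n.+1 by rewrite /g ltn_eqF.
  have h2 := sol n.+1 (leqnSn _); have h3 := sol n.+2 (leqnn _).
  rewrite gn1 in h2; rewrite gn2 dsumS in h3.
  have := fE n.+2 (leqnn _); rewrite (sf n.+3) ?ltnn ?andbF// mulr0 subr0 /= => h1.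
  have g1 : g 1%N = d n.+2 + psum d n.+2.
    by rewrite h1 h3 h2; ring.
  have W : wsum d n.+3 = 2 * f n.+2.
    by rewrite h3 g1 -dsumS /dsum wsumS; ring.
  exists (f n.+2 - r); apply: (addIr (2 * r)); rewrite -rE W; ring.
pose t := d n.+2 + psum d n.+2.
pose f j := if (0 < j <= n.+2)%N then
  (if j == n.+2 then q + r else j%:Z * t - dsum d j) else 0.
exists f; split=> [i /negPf|]; first by rewrite /f => ->.
have fE j : (j < n.+2)%N -> f j = j%:Z * t - dsum d j.
  by rewrite /f; case: j => [|j /= jn]; rewrite ?dsum0 ?mul0r ?subr0// ltnW//= ltn_eqF.
have fn : 2 * f n.+2 = n.+2%:Z * t - dsum d n.+2.
  have -> : n.+2%:Z * t - dsum d n.+2 = wsum d n.+2 + n.+2%:Z * d n.+2.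
    by rewrite /t /dsum; ring.
  by rewrite -wsumS rE qE /f leqnn eqxx /=; ring.
case=> // j /= jn; rewrite eqSS; have [->|jN] := eqVneq j n.+1.
  have -> : f n.+3 = 0 by rewrite /f ltnn andbF.
  by rewrite fn [f n.+1]fE// gtn_eqF// mulr0 subr0 !dsumS /t; lia.
have := sol_chain d t j; rewrite -(fE j) -?(fE j.+1); try lia.
have [->|jN'] := eqVneq j n; first by rewrite -fn eqxx.
by rewrite -fE; try lia; rewrite eqSS (negPf jN') mul1r.
Qed.

(** Putting [f (n - 1) + f n] in place of [f (n - 1)] gives a simply laced chain up to the fork. The
    two equations at the tips of the fork add up to twice the last difference of that chain, which
    is the first congruence; solving each of them for [f (n - 1)] or [f n] needs a halving, which
    gives the other two. *)
Lemma chain_D d n : (4 <= n)%N ->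
  (exists f, supported n f /\
    forall j, (0 < j <= n)%N ->
      d j = 2 * f j - (if j == n then 0 else 1) * f j.-1
        - (if j.+1 == n then 0 else 1) * f j.+1
        - (if (j == n) || (j.+2 == n) then 1 else 0) * f (if j == n then n.-2 else n)) <->
  [/\ exists q, d n.-1 + d n = q * 2,
      exists q, \sum_(1 <= i < n.-1 | odd i) 2 * d i + n%:Z * d n.-1 + (n%:Z - 2) * d n = q * 4 &
      exists q, \sum_(1 <= i < n.-1 | odd i) 2 * d i + (n%:Z - 2) * d n.-1 + n%:Z * d n = q * 4].
Proof.
case: n => [//|[//|[//|[//|p]]]] _; have [r rE] := wsum_odd d p.+3; rewrite /= -mulr_sumr.
set O := \sum_(1 <= i < p.+3 | odd i) d i in rE *.
have -> : p.+4%:Z - 2 = p.+2%:Z :> int by lia.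
have -> : p.+4%:Z = p.+2%:Z + 2 :> int by lia.
set P := psum d p.+3; set N := p.+2%:Z.
have dN : dsum d p.+2 = N * P - wsum d p.+3.
  have : dsum d p.+2 + P = p.+3%:Z * P - wsum d p.+3 by rewrite -dsumS.
  have -> : p.+3%:Z = N + 1 :> int by rewrite /N; lia.
  by move=> h; apply: (addIr P); rewrite h; ring.
have p1 : (p == p.+1) = false by lia.
have p2 : (p.+1 == p) = false by lia.
have p3 : (p.+2 == p) = false by lia.
split=> [[f [sf fE]]|[[e eE] [q qE] _]].
  pose g j : int := if j == p.+3 then f p.+3 + f p.+4 else f j.
  have sol : forall j, (j <= p.+3)%N -> g j = j%:Z * g 1 - dsum d j.
    apply: chain_sol => [|j /andP[j0 jn]]; first exact: sf.
    rewrite fE; last by lia.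
    have -> : (j == p.+4) = false by lia.
    rewrite /g !eqSS /= (ltn_eqF jn).
    have -> : (j.-1 == p.+3) = false by lia.
    by have [->|jp] := eqVneq j p.+2; ring.
  have F2 : f p.+2 = N * g 1 - dsum d p.+2.
    by rewrite -(sol p.+2)// /g ltn_eqF.
  have F3 : f p.+3 + f p.+4 = (N + 1) * g 1 - (dsum d p.+2 + P).
    have := sol p.+3 (leqnn _); rewrite {1}/g eqxx dsumS => ->.
    by congr (_ * _ - _); rewrite /N; lia.
  have d3 : d p.+3 = 2 * f p.+3 - f p.+2.
    by rewrite fE ?leqnSn// !eqSS eqxx p1 p2 /=; ring.
  have d4 : d p.+4 = 2 * f p.+4 - f p.+2.
    by rewrite fE ?leqnn// (sf p.+4.+1) ?ltnn ?andbF// !eqSS eqxx p2 /=; ring.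
  have B : f p.+4 = (N + 1) * g 1 - (dsum d p.+2 + P) - f p.+3.
    by rewrite -F3; ring.
  split.
  - by exists (g 1 - P); rewrite d3 d4 B F2 dN; ring.
  - exists (f p.+3 - r); rewrite d3 d4 B F2 dN rE; ring.
  - exists (f p.+4 - r); rewrite d3 d4 B F2 dN rE; ring.
(* With [n = p + 4], [e] is the last difference of the chain, and [F] and [A] are the entries at
   [n - 2] and [n - 1]. The second congruence, halved, becomes [d (n - 1) = 2 A - F]. *)
pose t := e + P; pose A := q + r; pose F := N * e + wsum d p.+3.
pose f j : int := if (0 < j <= p.+4)%N then
  (if j == p.+4 then e + F - A else if j == p.+3 then A else j%:Z * t - dsum d j) else 0.
have d3 : d p.+3 = 2 * A - F.
  apply: (mulfI (isT : (2 : int) != 0)).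
  have : 2 * O + N * (d p.+3 + d p.+4) + 2 * d p.+3 = q * 4 by rewrite -qE; ring.
  rewrite eE => h; apply: (addrI (2 * O + N * (e * 2))); rewrite h /A /F rE; ring.
have d4 : d p.+4 = 2 * (e + F - A) - F.
  by apply: (addrI (d p.+3)); rewrite eE d3; ring.
have fE j : (j < p.+3)%N -> f j = j%:Z * t - dsum d j.
  rewrite /f; case: j => [|j jn]; first by rewrite dsum0 mul0r subr0.
  have -> : (0 < j.+1 <= p.+4)%N by lia.
  by rewrite !ifF //; lia.
have f2 : f p.+2 = F by rewrite fE// dN /t /F -/N; ring.
have f3 : f p.+3 = A by rewrite /f leqnSn !eqSS ltn_eqF//= eqxx.
have f4 : f p.+4 = e + F - A by rewrite /f leqnn eqxx.
exists f; split=> [i /negPf|]; first by rewrite /f => ->.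
case=> // j /= jn; rewrite !eqSS.
have [->|j3] := eqVneq j p.+3.
  by rewrite !eqSS p2 p3 f4 f2 d4 /= /f ltnn andbF; ring.
have [->|j2] := eqVneq j p.+2.
  by rewrite !eqSS p2 f3 f2 d3 /=; ring.
have [->|j1] := eqVneq j p.+1.
  rewrite f3 f4 f2 [f p.+1]fE//= (sol_chain d t) -fE// f2.
  have -> : p.+3%:Z * t - dsum d p.+3 = A + (e + F - A).
    rewrite dsumS dN -/P; have -> : p.+3%:Z = N + 1 :> int by rewrite /N; lia.
    by rewrite /t /F; ring.
  by rewrite -fE//; ring.
by rewrite (sol_chain d t) -!fE; try lia; ring.
Qed.

End Congruences.

(** * Cartan matrices of the classical types *)

Lemma sum_delta (n : nat) (m : nat -> int) (x : int) (a : nat) :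
  (forall i, ~~ (0 < i <= n)%N -> m i = 0) ->
  \sum_(1 <= i < n.+1) m i * (x * (i == a)%:R) = x * m a.
Proof.
move=> sm; case: (boolP (0 < a <= n)%N) => ha; last first.
  rewrite (sm _ ha) mulr0 big_nat big1// => i /andP[i0 iN].
  by have [ia|_] := eqVneq i a; [move: ha; rewrite -ia i0 -ltnS iN|rewrite !mulr0].
rewrite (bigD1_seq a) ?iota_uniq ?mem_index_iota ?ltnS//= eqxx mulr1 big1 => [|i /negPf ->].
  by rewrite addr0 mulrC.
by rewrite !mulr0.
Qed.

Section CartanMatrices.
Context {R : realType} {V : vectType R} (ip : {dot V for idfun}) (Phi : {fset V}).
Context {n : nat} (alpha : n.-tuple V).
Hypothesis root_sys : root_system ip Phi.
Hypothesis simple : simple_system Phi alpha.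
Local Notation coroot := (coroot ip).
Local Notation al := (tnth alpha).
Local Notation sr := (sroot alpha).
Local Notation C i j := (ip (sr i) (coroot (sr j))).

Lemma sroot_tnth i : (0 < i <= n)%N -> exists2 o : 'I_n, o = i.-1 :> nat & sr i = al o.
Proof.
case: i => // i iN; exists (Ordinal (iN : (i < n)%N)) => //.
by rewrite (tnth_nth 0).
Qed.

Lemma sroot_root i : (0 < i <= n)%N -> sr i \in Phi.
Proof. by move=> /sroot_tnth[o _ ->]; apply: simple_root simple _. Qed.

Lemma cartan_le0 i j : (0 < i <= n)%N -> (0 < j <= n)%N -> i != j -> C i j <= 0.
Proof.
move=> hi hj ij; have [[o oi ->] [o' oj ->]] := (sroot_tnth hi, sroot_tnth hj).
apply: (cartan_simple_le0 root_sys simple); apply: contra ij => /eqP oo.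
by move: oi oj; rewrite oo; lia.
Qed.

Lemma cartan_self i : (0 < i <= n)%N -> C i i = 2.
Proof. by move=> /sroot_root /(root_neq0 root_sys); apply: coroot_self. Qed.

Lemma bond_sym a b : bond ip a b = bond ip b a.
Proof. exact: mulrC. Qed.

Lemma cartan_bond0 i j : (0 < i <= n)%N -> (0 < j <= n)%N ->
  bond ip (sr i) (sr j) = 0 -> C i j = 0.
Proof.
move=> /sroot_root /(root_neq0 root_sys) hi /sroot_root /(root_neq0 root_sys) hj.
move=> /eqP; rewrite mulf_eq0 => /orP[/eqP //|].
by rewrite coroot_ip_eq0// ipC -(coroot_ip_eq0 ip _ hj) => /eqP.
Qed.

Lemma cartan_bond1 i j : (0 < i <= n)%N -> (0 < j <= n)%N -> i != j ->
  bond ip (sr i) (sr j) = 1 -> C i j = -1.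
Proof.
move=> hi hj ij; have := cartan_le0 hi hj ij.
have := cartan_le0 hj hi; rewrite eq_sym => /(_ ij).
have /intrP[u uE] := root_int root_sys (sroot_root hi) (sroot_root hj).
have /intrP[v vE] := root_int root_sys (sroot_root hj) (sroot_root hi).
rewrite /bond uE vE !lerz0 -rmorphM -[1]/(1%:~R) => v0 u0 /intr_inj uv.
have v0' : v != 0 by apply: contra_eqN uv => /eqP ->; rewrite mulr0.
have u0' : u != 0 by apply: contra_eqN uv => /eqP ->; rewrite mul0r.
by rewrite (_ : u = -1)//; nia.
Qed.

(** The two Cartan numbers are nonpositive integers with product 2, and their ratio is that of the
    squared lengths, so the one of larger size is [C i j]. *)
Lemma cartan_bond2 i j : (0 < i <= n)%N -> (0 < j <= n)%N -> i != j ->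
  bond ip (sr i) (sr j) = 2 -> ip (sr j) (sr j) < ip (sr i) (sr i) ->
  C i j = (-2)%:~R /\ C j i = (-1)%:~R.
Proof.
move=> hi hj ij; have := cartan_le0 hi hj ij.
have := cartan_le0 hj hi; rewrite eq_sym => /(_ ij).
have /intrP[u uE] := root_int root_sys (sroot_root hi) (sroot_root hj).
have /intrP[v vE] := root_int root_sys (sroot_root hj) (sroot_root hi).
have /(root_neq0 root_sys)/(ip_gt0 ip) ni := sroot_root hi.
have /(root_neq0 root_sys)/(ip_gt0 ip) nj := sroot_root hj.
have sym : C i j * ip (sr j) (sr j) = C j i * ip (sr i) (sr i).
  rewrite /Defs.coroot !ipZr (ipC ip (sr j) (sr i)).
  by have := lt0r_neq0 ni; have := lt0r_neq0 nj => ? ?; field; apply/andP.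
rewrite /bond; rewrite uE vE in sym *; rewrite !lerz0 -rmorphM -[2]/(2%:~R) => v0 u0 /intr_inj uv lt.
have uv' : u < v.
  rewrite ltNge; apply/negP => vu.
  have : v < 0 by nia.
  rewrite -(ltrz0 R) => vn.
  have : v%:~R * ip (sr i) (sr i) < v%:~R * ip (sr j) (sr j) by rewrite ltr_nM2l.
  rewrite -sym ltr_pM2r// ltr_int; lia.
have v1 : v = -1.
  have : -1 <= v by nia.
  have : v != 0 by apply: contra_eqN uv => /eqP ->; rewrite mulr0.
  by lia.
by rewrite v1 (_ : u = -2); [split|lia].
Qed.

Variable (d : nat -> int).

Definition in_cartan_image := exists m : 'I_n -> int, forall j : 'I_n,
  (d j.+1)%:~R = \sum_i (m i)%:~R * ip (al i) (coroot (al j)) :> R.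

(** Column [j] has 2 on the diagonal and [- X j], [- Y j] at the neighbours below and above; [Z j]
    and [a j] allow one further neighbour, for the fork in type D. *)
Lemma cartan_image_columns (X Y Z : nat -> int) (a : nat -> nat) :
  (forall i j, (0 < i <= n)%N -> (0 < j <= n)%N -> C i j =
     (2 * (i == j)%:R - X j * (i == j.-1)%:R - Y j * (i == j.+1)%:R
        - Z j * (i == a j)%:R)%:~R) ->
  in_cartan_image <-> exists f, supported n f /\
    forall j, (0 < j <= n)%N ->
      d j = 2 * f j - X j * f j.-1 - Y j * f j.+1 - Z j * f (a j).
Proof.
move=> CE.
have sumE f j : supported n f -> (0 < j <= n)%N ->
    \sum_(i < n) (f i.+1)%:~R * ip (al i) (coroot (sr j)) =
    (2 * f j - X j * f j.-1 - Y j * f j.+1 - Z j * f (a j))%:~R :> R.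
  move=> sf hj; rewrite -!(@sum_delta n)// -!sumrB.
  rewrite big_add1 big_mkord rmorph_sum; apply: eq_bigr => i _ /=.
  have <- : sr i.+1 = al i by rewrite /sroot (tnth_nth 0).
  by rewrite CE ?ltn_ord// -rmorphM; congr (_%:~R); ring.
split=> [[m mE]|[f [sf fE]]].
  pose f i : int := if i is i'.+1 then if insub i' is Some o then m o else 0 else 0.
  have fE (i : 'I_n) : f i.+1 = m i by rewrite /f valK.
  have sf : supported n f.
    by case=> //= i; rewrite -leqNgt => ni; rewrite insubF// ltnNge ni.
  exists f; split=> // j hj; have [o oj sro] := sroot_tnth hj.
  have := mE o; rewrite oj prednK; last by case/andP: hj.
  rewrite -sro; under eq_bigr => i _ do rewrite -fE.
  by rewrite sumE// => /intr_inj.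
exists (fun i => f i.+1) => j; have <- : sr j.+1 = al j by rewrite /sroot (tnth_nth 0).
by rewrite sumE ?ltn_ord// -fE ?ltn_ord.
Qed.
End CartanMatrices.

Lemma ex_supported_iff n (F G : (nat -> int) -> nat -> int) (d : nat -> int) :
  (forall f j, (0 < j <= n)%N -> F f j = G f j) ->
  (exists f, supported n f /\ forall j, (0 < j <= n)%N -> d j = F f j) <->
  (exists f, supported n f /\ forall j, (0 < j <= n)%N -> d j = G f j).
Proof.
move=> FG; split=> -[f [sf fE]]; exists f; split=> // j hj; rewrite fE ?FG//.
Qed.

(** * Congruences for the Cartan image in types A, B, C and D *)

Section Types.
Context {R : realType} {V : vectType R} (ip : {dot V for idfun}) (Phi : {fset V}).
Context {n : nat} (alpha : n.-tuple V).
Hypothesis root_sys : root_system ip Phi.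
Hypothesis simple : simple_system Phi alpha.
Variable (d : nat -> int).
Local Notation sr := (sroot alpha).
Local Notation C i j := (ip (sr i) (coroot ip (sr j))).
Local Notation image := (in_cartan_image ip alpha d).

Lemma cartan_intro (c : nat -> nat -> int) :
  (forall i j, (0 < i)%N -> (i < j)%N -> (j <= n)%N ->
     C i j = (c i j)%:~R /\ C j i = (c j i)%:~R) ->
  (forall i, (0 < i <= n)%N -> c i i = 2) ->
  forall i j, (0 < i <= n)%N -> (0 < j <= n)%N -> C i j = (c i j)%:~R.
Proof.
move=> cij cii i j /andP[i0 iN] /andP[j0 jN].
have [ij|ij|<-] := ltngtP i j.
- by have [] := cij i j i0 ij jN.
- by have [] := cij j i j0 ij iN.
by rewrite cii ?i0// (cartan_self root_sys simple)// i0.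
Qed.

Lemma cartan_simply_laced i j b : (0 < i)%N -> (i < j)%N -> (j <= n)%N ->
  bond ip (sr i) (sr j) = b%:R -> (b <= 1)%N ->
  C i j = (- b%:Z)%:~R /\ C j i = (- b%:Z)%:~R.
Proof.
move=> i0 ij jN; have hi : (0 < i <= n)%N by lia.
have hj : (0 < j <= n)%N by lia.
have nij : i != j by lia. have nji : j != i by lia.
case: b => [|[|//]] bE _; rewrite rmorphN /=.
  rewrite oppr0; split; apply: (cartan_bond0 root_sys simple) => //.
  by rewrite bond_sym.
by split; apply: (cartan_bond1 root_sys simple) => //; rewrite bond_sym.
Qed.

Lemma image_A : type_A ip alpha -> image <-> exists q, wsum d n.+1 = q * n.+1%:Z.
Proof.
move=> tA; rewrite -chain_A.
rewrite (@cartan_image_columns _ _ ip _ alpha d (fun=> 1) (fun=> 1)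
  (fun=> 0) (fun=> 0)).
  by apply: ex_supported_iff => f j _; ring.
apply: cartan_intro => [i j i0 ij jN|i /andP[i0 iN]]; last first.
  have -> : (i == i.-1) = false by lia.
  have -> : (i == i.+1) = false by lia.
  by rewrite eqxx mul0r !mulr0.
have := @cartan_simply_laced i j (j == i.+1) i0 ij jN (tA i j i0 ij jN) (leq_b1 _).
move=> [-> ->]; split; congr (_%:~R).
  have -> : (i == j) = false by lia.
  have -> : (i == j.+1) = false by lia.
  have -> : (i == j.-1) = (j == i.+1) by lia.
  by rewrite mul0r; case: (j == i.+1).
have -> : (j == i) = false by lia.
have -> : (j == i.-1) = false by lia.
by rewrite mul0r; case: (j == i.+1).
Qed.

Lemma image_B : type_B ip alpha -> image <-> exists q, d n = q * 2.
Proof.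
move=> [n2 tB lenB]; rewrite -chain_B//.
rewrite (@cartan_image_columns _ _ ip _ alpha d (fun j => if j == n then 2 else 1) (fun=> 1)
  (fun=> 0) (fun=> 0)).
  by apply: ex_supported_iff => f j _; ring.
apply: cartan_intro => [i j i0 ij jN|i /andP[i0 iN]]; last first.
  have -> : (i == i.-1) = false by lia.
  have -> : (i == i.+1) = false by lia.
  by rewrite eqxx mul0r !mulr0.
have -> : (i == j) = false by lia.
have -> : (i == j.+1) = false by lia.
have -> : (i == j.-1) = (j == i.+1) by lia.
have -> : (j == i) = false by lia.
have -> : (j == i.-1) = false by lia.
have -> : (i == n) = false by lia.
have := tB i j i0 ij jN; have [jE|_] := eqVneq j i.+1; last first.
  move=> bE; have [//|-> ->] := @cartan_simply_laced i j 0 i0 ij jN bE.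
  by split; congr (_%:~R); rewrite mul0r !mulr0.
have [jn|_] := eqVneq j n; last first.
  move=> bE; have [//|-> ->] := @cartan_simply_laced i j 1 i0 ij jN bE.
  by split; congr (_%:~R); rewrite mul0r !mulr0.
move=> bE; have [||||-> ->] := cartan_bond2 root_sys simple _ _ _ bE; try lia.
  by rewrite jn; apply: lenB; lia.
by split; congr (_%:~R); rewrite mul0r !mulr0.
Qed.

Lemma image_C : type_C ip alpha ->
  image <-> exists q, \sum_(1 <= j < n.+1 | odd j) d j = q * 2.
Proof.
move=> [n2 tC lenC]; rewrite -chain_C//.
rewrite (@cartan_image_columns _ _ ip _ alpha d (fun=> 1) (fun j => if j.+1 == n then 2 else 1)
  (fun=> 0) (fun=> 0)).
  by apply: ex_supported_iff => f j _; ring.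
apply: cartan_intro => [i j i0 ij jN|i /andP[i0 iN]]; last first.
  have -> : (i == i.-1) = false by lia.
  have -> : (i == i.+1) = false by lia.
  by rewrite eqxx mul0r !mulr0.
have -> : (i == j) = false by lia.
have -> : (i == j.+1) = false by lia.
have -> : (i == j.-1) = (j == i.+1) by lia.
have -> : (j == i) = false by lia.
have -> : (j == i.-1) = false by lia.
have := tC i j i0 ij jN; have [jE|_] := eqVneq j i.+1; last first.
  move=> bE; have [//|-> ->] := @cartan_simply_laced i j 0 i0 ij jN bE.
  by split; congr (_%:~R); rewrite mul0r !mulr0.
rewrite -jE; have [jn|_] := eqVneq j n; last first.
  move=> bE; have [//|-> ->] := @cartan_simply_laced i j 1 i0 ij jN bE.
  by split; congr (_%:~R); rewrite mul0r !mulr0.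
(* The bond is reversed because here the last root [sr j] is the longer one. *)
rewrite bond_sym => bE; have [||||-> ->] := cartan_bond2 root_sys simple _ _ _ bE; try lia.
  by rewrite jn; apply: lenC; lia.
by split; congr (_%:~R); rewrite mul0r !mulr0.
Qed.

Lemma image_D : type_D ip alpha ->
  image <->
  [/\ exists q, d n.-1 + d n = q * 2,
      exists q, \sum_(1 <= i < n.-1 | odd i) 2 * d i
        + n%:Z * d n.-1 + (n%:Z - 2) * d n = q * 4 &
      exists q, \sum_(1 <= i < n.-1 | odd i) 2 * d i
        + (n%:Z - 2) * d n.-1 + n%:Z * d n = q * 4].
Proof.
move=> [n4 tD]; rewrite -chain_D//.
(* The last root is joined to number [n - 2] and not to [n - 1], so the chain weights vanish between
   [n - 1] and [n], and the extra neighbour links [n - 2] with [n]. *)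
apply: (@cartan_image_columns _ _ ip _ alpha d (fun j => if j == n then 0 else 1)
  (fun j => if j.+1 == n then 0 else 1)
  (fun j => if (j == n) || (j.+2 == n) then 1 else 0)
  (fun j => if j == n then n.-2 else n)).
apply: cartan_intro => [i j i0 ij jN|i /andP[i0 iN]]; last first.
  have -> : (i == i.-1) = false by lia.
  have -> : (i == i.+1) = false by lia.
  have [iE|ne] /= := eqVneq i n.
    have -> : (i == n.-2) = false by lia.
    by rewrite eqxx !mulr0.
  by rewrite (negPf ne) eqxx !mulr0.
have := @cartan_simply_laced i j (if j == n then i == (n - 2)%N else j == i.+1)
  i0 ij jN (tD i j i0 ij jN).
case=> [|-> ->]; first by case: (if _ then _ else _).
have -> : (i == j) = false by lia.
have -> : (i == j.+1) = false by lia.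
have -> : (i == j.-1) = (j == i.+1) by lia.
have -> : (j == i) = false by lia.
have -> : (j == i.-1) = false by lia.
have -> : (i == n) = false by lia.
have [jn|jn] /= := eqVneq j n.
  have -> : (i == n.-2) = (i == (n - 2)%N) by lia.
  have -> : (j == i.+1) = (i.+1 == n) by lia.
  rewrite !mulr0 mul0r.
  have -> : (i.+2 == n) = (i == (n - 2)%N) by lia.
  have [iE|_] := eqVneq i.+1 n.
    have -> : (i == (n - 2)%N) = false by lia.
    by [].
  by case: (i == (n - 2)%N).
have -> : (i.+1 == n) = false by lia.
have -> : (i == n) = false by lia.
by rewrite !mulr0; case: (j == i.+1).
Qed.

End Types.

(** * Orientation of alcoves and congruences of Shi coefficients *)

Theorem corollary4p1 (R : realType) (V : vectType R) (ip : {dot V for idfun})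
    (Phi : {fset V}) (n : nat) (alpha : n.-tuple V)
    (root_sys : root_system ip Phi) (irr : irreducible_roots ip Phi)
    (simple : simple_system Phi alpha)
    (w w' : V -> V) (Hw : affine_weyl ip Phi w) (Hw' : affine_weyl ip Phi w')
    (same_component : exists Z,
      [/\ irreducible_component (shi_variety ip Phi alpha) Z,
          Z (shi_point ip Phi alpha w) & Z (shi_point ip Phi alpha w')]) :
  let k (j : nat) : int := shi_coef ip Phi alpha w (sroot alpha j) in
  let k' (j : nat) : int := shi_coef ip Phi alpha w' (sroot alpha j) in
  [/\ type_A ip alpha ->
        (same_orientation Phi w w' <->
         (\sum_(1 <= j < n.+1) j%:Z * k j
            = \sum_(1 <= j < n.+1) j%:Z * k' j %[mod n.+1])%Z),
      type_B ip alpha ->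
        (same_orientation Phi w w' <-> (k n = k' n %[mod 2])%Z),
      type_C ip alpha ->
        (same_orientation Phi w w' <->
         (\sum_(1 <= j < n.+1 | odd j) k j
            = \sum_(1 <= j < n.+1 | odd j) k' j %[mod 2])%Z) &
      type_D ip alpha ->
        (same_orientation Phi w w' <->
         [/\ (k n.-1 + k n = k' n.-1 + k' n %[mod 2])%Z,
             (\sum_(1 <= i < n.-1 | odd i) 2 * k i
                + n%:Z * k n.-1 + (n%:Z - 2) * k n
              = \sum_(1 <= i < n.-1 | odd i) 2 * k' i
                + n%:Z * k' n.-1 + (n%:Z - 2) * k' n %[mod 4])%Z &
             (\sum_(1 <= i < n.-1 | odd i) 2 * k i
                + (n%:Z - 2) * k n.-1 + n%:Z * k n
              = \sum_(1 <= i < n.-1 | odd i) 2 * k' i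
                + (n%:Z - 2) * k' n.-1 + n%:Z * k' n %[mod 4])%Z])].
Proof.
move=> k k'; pose d j := k' j - k j.
have orient : same_orientation Phi w w' <-> in_cartan_image ip alpha d.
  rewrite (same_orientation_iff root_sys simple Hw Hw' same_component).
  by split=> -[m mE]; exists m => j; rewrite -mE /d /k /k' /sroot (tnth_nth 0).
have wsumE r : wsum d r = \sum_(1 <= j < r) j%:Z * k' j - \sum_(1 <= j < r) j%:Z * k j.
  by rewrite -sumrB; apply: eq_bigr => j _; rewrite -mulrBr.
have osumE r : \sum_(1 <= j < r | odd j) d j =
    \sum_(1 <= j < r | odd j) k' j - \sum_(1 <= j < r | odd j) k j.
  by rewrite -sumrB.
split=> type; rewrite orient.
- by rewrite (image_A root_sys simple d type) eqz_modP wsumE.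
- by rewrite (image_B root_sys simple d type) eqz_modP.
- by rewrite (image_C root_sys simple d type) eqz_modP osumE.
rewrite (image_D root_sys simple d type) -!mulr_sumr osumE /d.
split=> -[h1 h2 h3]; split.
- by case: h1 => q qE; apply/eqz_modP; exists q; rewrite -qE; ring.
- by case: h2 => q qE; apply/eqz_modP; exists q; rewrite -qE; ring.
- by case: h3 => q qE; apply/eqz_modP; exists q; rewrite -qE; ring.
- by move/eqz_modP: h1 => [q qE]; exists q; rewrite -qE; ring.
- by move/eqz_modP: h2 => [q qE]; exists q; rewrite -qE; ring.
- by move/eqz_modP: h3 => [q qE]; exists q; rewrite -qE; ring.
Qed.
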